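(* Let $G$ be a finite simple graph that is $(P_3\cup P_2, W_4)$-free. Then $\chi(G)\le 2\omega(G)$.
   Context: All graphs are finite and simple. $P_k$ denotes the path on $k$ vertices and $C_k$ the cycle on $k$ vertices. For vertex-disjoint graphs $H,F$, $H\cup F$ is their disjoint union, and $H+F$ is the join (the disjoint union plus all edges between $V(H)$ and $V(F)$). $W_4=K_1+C_4$ (a vertex joined to all vertices of an induced 4-cycle). A graph $G$ is $(H_1,H_2)$-free if it has no induced subgraph isomorphic to $H_1$ or to $H_2$. $\chi(G)$ is the chromatic number and $\omega(G)$ the clique number of $G$. *)

(* Defs.v *)
From mathcomp Require Import all_boot.

Set Implicit Arguments.
Unset Strict Implicit.
Unset Printing Implicit Defensive.

Record sgraph := SGraph {
  vertex :> finType;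
  adj : rel vertex;
  adj_sym : symmetric adj;
  adj_irrefl : irreflexive adj }.

Arguments adj {G} x y : rename.

Section Constructions.

Lemma complete_sym n : symmetric (fun i j : 'I_n => i != j).
Proof. by move=> i j; rewrite eq_sym. Qed.
Lemma complete_irrefl n : irreflexive (fun i j : 'I_n => i != j).
Proof. by move=> i; rewrite eqxx. Qed.
Definition complete_graph n := SGraph (@complete_sym n) (@complete_irrefl n).

Definition path_adj n (i j : 'I_n) := (i.+1 == j :> nat) || (j.+1 == i :> nat).
Lemma path_sym n : symmetric (@path_adj n).
Proof. by move=> i j; rewrite /path_adj orbC. Qed.
Lemma path_irrefl n : irreflexive (@path_adj n).
Proof. by move=> i; rewrite /path_adj orbb eqn_leq ltnn. Qed.
Definition path_graph n := SGraph (@path_sym n) (@path_irrefl n).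

(* The cycle on n vertices only for n >= 3; the test i != j is redundant there
   (it only removes the loop at the single vertex when n = 1). *)
Definition cycle_adj n (i j : 'I_n) :=
  (i != j) && ((i.+1 %% n == j :> nat) || (j.+1 %% n == i :> nat)).
Lemma cycle_sym n : symmetric (@cycle_adj n).
Proof. by move=> i j; rewrite /cycle_adj eq_sym orbC. Qed.
Lemma cycle_irrefl n : irreflexive (@cycle_adj n).
Proof. by move=> i; rewrite /cycle_adj eqxx. Qed.
Definition cycle_graph n := SGraph (@cycle_sym n) (@cycle_irrefl n).

Variables H F : sgraph.

Definition union_adj (u v : H + F) :=
  match u, v with
  | inl x, inl y => adj x y
  | inr x, inr y => adj x y
  | _, _ => false
  end.
Lemma union_sym : symmetric union_adj.
Proof. by case=> x [] y //=; rewrite adj_sym. Qed.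
Lemma union_irrefl : irreflexive union_adj.
Proof. by case=> x /=; rewrite adj_irrefl. Qed.
Definition disjoint_union := SGraph union_sym union_irrefl.

Definition join_adj (u v : H + F) :=
  match u, v with
  | inl x, inl y => adj x y
  | inr x, inr y => adj x y
  | _, _ => true
  end.
Lemma join_sym : symmetric join_adj.
Proof. by case=> x [] y //=; rewrite adj_sym. Qed.
Lemma join_irrefl : irreflexive join_adj.
Proof. by case=> x /=; rewrite adj_irrefl. Qed.
Definition join := SGraph join_sym join_irrefl.

End Constructions.

Definition wheel4 : sgraph := join (complete_graph 1) (cycle_graph 4).

Section Induced.
Variables (G : sgraph) (A : {set G}).

Definition induced_adj (u v : {x : G | x \in A}) := adj (val u) (val v).
Lemma induced_sym : symmetric induced_adj.
Proof. by move=> u v; rewrite /induced_adj adj_sym. Qed.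
Lemma induced_irrefl : irreflexive induced_adj.
Proof. by move=> u; rewrite /induced_adj adj_irrefl. Qed.
Definition induced := SGraph induced_sym induced_irrefl.

End Induced.

Definition isomorphic (G H : sgraph) : Prop :=
  exists2 f : G -> H, bijective f & {mono f : x y / adj x y}.

Definition free (H G : sgraph) : Prop :=
  forall A : {set G}, ~ isomorphic (induced A) H.

Definition free2 (H1 H2 G : sgraph) : Prop := free H1 G /\ free H2 G.

Section Invariants.
Variable G : sgraph.

Definition colorable (k : nat) : bool :=
  [exists c : {ffun G -> 'I_k}, forall x, forall y, adj x y ==> (c x != c y)].

Lemma colorable_ex : exists k, colorable k.
Proof.
exists #|G|; apply/existsP; exists [ffun x => enum_rank x].
apply/forallP=> x; apply/forallP=> y; apply/implyP; rewrite !ffunE.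
by apply: contraTneq => /enum_rank_inj->; rewrite adj_irrefl.
Qed.

Definition chi : nat := ex_minn colorable_ex.

Definition clique (A : {set G}) : bool :=
  [forall x in A, forall y in A, (x != y) ==> adj x y].

Definition omega : nat := \max_(A : {set G} | clique A) #|A|.

End Invariants.

(* Main.v *)
Require Import Defs.
From mathcomp Require Import all_boot zify.

Set Implicit Arguments.
Unset Strict Implicit.
Unset Printing Implicit Defensive.

(* Fix a maximum clique K, put w = |K|, and let the type S(x) of a vertex x
   outside K be its set of neighbours in K. Since G is W4-free, adjacent vertices
   outside K have nested or disjoint types; since it is (P3 u P2)-free, the types
   of an induced P3 cover all but at most one vertex of K. The vertices missing
   exactly one vertex of K ([almost]) form a stable set. The others ([deep]) are split into
   a P3-free part B, a disjoint union of cliques which by Hall's theorem can be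
   coloured together with K by w colours, and a remainder needing at most w - 1
   colours. The main tool for the remainder is that a set of deep vertices whose
   adjacent members have nested types of size at least a is chordal and has clique
   number at most w - a.

   For w >= 5, take two adjacent deep vertices with nested types, the larger type T
   of maximum size subject to |T| <= w - 3. The split is by the traces of the
   types on U = K - T: B consists of the types contained in T and of a clique of
   vertices with small traces, and the large traces pairwise intersect. If there
   is no such pair, few colours suffice for the remainder. The values w <= 4 need
   separate arguments; for w = 3 every triangle can play the role of K. *)

(** * Hall's marriage theorem *)

Lemma hall (T : finType) (A : T -> {set T}) (X : {set T}) :
  (forall Y : {set T}, Y \subset X -> #|Y| <= #|\bigcup_(y in Y) A y|) ->
  exists2 f : T -> T, {in X &, injective f} & forall x, x \in X -> f x \in A x.
Proof.
elim: {X}_.+1 {-2}X (ltnSn #|X|) A => // n IHn X; rewrite ltnS => leXn A hallA.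
have [->|[x0 x0X]] := set_0Vmem X.
  by exists id => x; rewrite inE.
(* A nonempty proper [Y] with exactly as many candidates as elements keeps them all: [X :\: Y] is
   matched outside [AY], with Hall's condition for [Z] there coming from the one for [Z :|: Y]. *)
case: (boolP [exists Y : {set T}, [&& Y \proper X, Y != set0 &
                #|\bigcup_(y in Y) A y| == #|Y|]]).
- case/existsP=> Y /and3P[YX Y0 /eqP tightY].
  have [f injf fA] : exists2 f : T -> T, {in Y &, injective f}
      & forall x, x \in Y -> f x \in A x.
    apply: IHn; first by apply: leq_trans leXn; apply: proper_card.
    by move=> Z ZY; apply: hallA; apply: subset_trans ZY (proper_sub YX).
  set AY := \bigcup_(y in Y) A y in tightY.
  have [g injg gA] : exists2 g : T -> T, {in X :\: Y &, injective g}
      & forall x, x \in X :\: Y -> g x \in A x :\: AY.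
    apply: (IHn _ _ (fun x => A x :\: AY)).
      apply: leq_trans leXn; rewrite cardsD.
      have := proper_card YX; have := proper_sub YX => /setIidPr ->.
      by move: Y0; rewrite -card_gt0; lia.
    move=> Z /subsetP ZXY.
    have ZY : [disjoint Z & Y].
      by rewrite disjoint_subset; apply/subsetP=> z /ZXY; rewrite !inE => /andP[].
    have ZYX : Z :|: Y \subset X.
      rewrite subUset (proper_sub YX) andbT.
      by apply/subsetP=> z /ZXY; rewrite !inE => /andP[].
    have := hallA _ ZYX; rewrite bigcup_setU cardsU.
    move: ZY; rewrite -setI_eq0 => /eqP ->; rewrite cards0 subn0.
    have -> : \bigcup_(i in Z) (A i :\: AY) = (\bigcup_(i in Z) A i) :\: AY.
      apply/setP=> z; rewrite inE; apply/bigcupP/andP.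
        by case=> i iZ; rewrite inE => /andP[zA zi]; split=> //; apply/bigcupP; exists i.
      by case=> zA /bigcupP[i iZ zi]; exists i; rewrite // inE zA.
    rewrite -/AY cardsU cardsD.
    have := subset_leq_card (subsetIr (\bigcup_(i in Z) A i) AY); lia.
  exists (fun x => if x \in Y then f x else g x) => [x y xX yX|x xX].
    have fY z : z \in Y -> f z \in AY by move=> zY; apply/bigcupP; exists z; auto.
    case: ifP => xY; case: ifP => yY.
    + exact: injf.
    + have := gA y; rewrite !inE yY yX => /(_ isT) /andP[+ _].
      by move=> /[swap] <-; rewrite fY.
    + have := gA x; rewrite !inE xY xX => /(_ isT) /andP[+ _].
      by move=> /[swap] ->; rewrite fY.
    + by apply: injg; rewrite inE ?xY ?yY.
  case: ifP => xY; first exact: fA.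
  by have := gA x; rewrite !inE xY xX => /(_ isT) /andP[].
(* Every nonempty proper subset now has a candidate to spare, so [x0] may take any [u]. *)
- move/existsPn=> loose.
  have [u uA] : exists u, u \in A x0.
    apply/set0Pn; rewrite -card_gt0.
    by have := hallA [set x0]; rewrite sub1set cards1 big_set1; apply.
  have [g injg gA] : exists2 g : T -> T, {in X :\ x0 &, injective g}
      & forall x, x \in X :\ x0 -> g x \in A x :\ u.
    apply: (IHn _ _ (fun x => A x :\ u)).
      by apply: leq_trans leXn; rewrite (cardsD1 x0 X) x0X.
    move=> Z /subsetP ZX.
    have [->|Z0] := eqVneq Z set0; first by rewrite cards0.
    have ZpX : Z \proper X.
      apply/properP; split; first by apply/subsetP=> z /ZX; rewrite !inE => /andP[].
      by exists x0 => //; apply/negP=> /ZX; rewrite !inE eqxx.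
    have := hallA _ (proper_sub ZpX).
    have := loose Z; rewrite ZpX Z0 /=.
    have -> : \bigcup_(i in Z) (A i :\ u) = (\bigcup_(i in Z) A i) :\ u.
      apply/setP=> z; rewrite !inE; apply/bigcupP/andP.
        by case=> i iZ; rewrite !inE => /andP[zA zi]; split=> //; apply/bigcupP; exists i.
      by case=> zA /bigcupP[i iZ zi]; exists i; rewrite // !inE zA.
    by rewrite (cardsD1 u (\bigcup_(i in Z) A i)); case: (u \in _) => /=; lia.
  exists (fun x => if x == x0 then u else g x) => [x y xX yX|x xX].
    case: eqP => [->|/eqP xx]; case: eqP => [->|/eqP yx] // e.
    + by have := gA y; rewrite !inE yx yX -e eqxx => /(_ isT).
    + by have := gA x; rewrite !inE xx xX e eqxx => /(_ isT).
    + by apply: injg => //; rewrite !inE ?xx ?yx.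
  case: eqP => [->//|/eqP xx].
  by have := gA x; rewrite !inE xx xX => /(_ isT) /andP[].
Qed.

(** * Colourings of vertex sets by natural numbers *)

Section Coloring.
Variable G : sgraph.
Implicit Types (A B : {set G}) (x y : G).

Definition col A c := exists2 f : G -> nat,
  forall x, x \in A -> f x < c &
  forall x y, x \in A -> y \in A -> adj x y -> f x != f y.

Definition stable A := forall x y, x \in A -> y \in A -> ~~ adj x y.

Lemma col_sub A B c d : A \subset B -> c <= d -> col B c -> col A d.
Proof.
move=> /subsetP AB cd [f fc fP]; exists f => [x /AB /fc|x y /AB xB /AB yB].
  by move/leq_trans; apply.
exact: fP.
Qed.

Lemma col_union A B c d : col A c -> col B d -> col (A :|: B) (c + d).
Proof.
move=> [f fc fP] [g gd gP].
exists (fun x => if x \in A then f x else c + g x) => [x|x y].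
  by rewrite inE; case: ifP => [/fc|_ /= /gd]; lia.
rewrite !inE; case: ifP => xA; case: ifP => yA /=.
- by move=> _ _; apply: fP.
- by move=> _ _ _; have := fc x xA; lia.
- by move=> _ _ _; have := fc y yA; lia.
- by move=> xB yB /(gP _ _ xB yB); rewrite eqn_add2l.
Qed.

Lemma col_stable A : stable A -> col A 1.
Proof. by move=> sA; exists (fun=> 0) => // x y xA yA xy; have := sA x y xA yA; rewrite xy. Qed.

(** Greedy colouring: a vertex with fewer than [c] neighbours is coloured last. *)
Lemma col_degenerate A c :
  (forall B, B \subset A -> B != set0 ->
     exists2 x, x \in B & #|[set y in B | adj x y]| < c) -> col A c.
Proof.
elim: {A}_.+1 {-2}A (ltnSn #|A|) => // n IHn A; rewrite ltnS => leAn degA.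
have [->|A0] := eqVneq A set0; first by exists (fun=> 0) => x; rewrite inE.
have [x xA degx] := degA A (subxx _) A0.
have [f fc fP] : col (A :\ x) c.
  apply: IHn; first by apply: leq_trans leAn; rewrite (cardsD1 x A) xA.
  by move=> B BA; apply: degA; apply: subset_trans BA (subD1set _ _).
have [k kc kP] : exists2 k, k < c & forall y, y \in A -> adj x y -> f y != k.
  (* [inord] asks for a successor; [c] exceeds the degree of [x], so it is positive and equals
     [c.-1.+1]. *)
  pose k_ y : 'I_c.-1.+1 := inord (f y).
  pose used := [set k_ y | y in [set y in A | adj x y]].
  have c0 : 0 < c by lia.
  have : used != setT.
    apply: contraTneq degx => e; rewrite -leqNgt.
    have := leq_imset_card k_ [set y in A | adj x y].
    by rewrite -/used e cardsT card_ord; lia.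
  rewrite -subTset => /subsetPn[k _ kN]; exists k; first by have := ltn_ord k; lia.
  move=> y yA xy; apply: contraNneq kN => fyk.
  apply/imsetP; exists y; rewrite ?inE ?yA //.
  by rewrite /k_ fyk inord_val.
exists (fun y => if y == x then k else f y) => [y yA|y z yA zA yz].
  by case: eqP => // /eqP yx; apply: fc; rewrite !inE yx.
have [yx|yx] := eqVneq y x; have [zx|zx] := eqVneq z x.
- by move: yz; rewrite yx zx adj_irrefl.
- by rewrite eq_sym kP // -yx.
- by rewrite kP // adj_sym -zx.
- by apply: fP => //; rewrite !inE ?yx ?zx.
Qed.

Lemma chi_col c : col setT c -> chi G <= c.
Proof.
case=> f fc fP; rewrite /chi; case: ex_minnP => k _; apply.
apply/existsP; exists [ffun x => Ordinal (fc x (in_setT x))].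
apply/forallP=> x; apply/forallP=> y; apply/implyP=> xy; rewrite !ffunE.
exact: fP.
Qed.

End Coloring.

(** The image of [f] induces a copy of [H]. This turns freeness into conditions on named
    vertices. *)
Lemma free_embedding (H G : sgraph) (f : H -> G) :
  free H G -> injective f -> {mono f : x y / adj x y} -> False.
Proof.
move=> frH injf monof; pose A := [set f x | x : H].
have fA x : f x \in A by apply: imset_f.
pose h x : induced A := exist (fun z : G => z \in A) (f x) (fA x).
have injh : injective h by move=> x y [] /injf.
have [g hK gK] : bijective h.
  apply: inj_card_bij => //.
  by rewrite card_sig (eq_card (B := A)) ?card_imset // => x.
apply: (frH A); exists g; first by exists h.
move=> u v; rewrite -{2}(gK u) -{2}(gK v).
by rewrite -[RHS]/(adj (f (g u)) (f (g v))) monof.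
Qed.

(** * Forbidden subgraphs *)

(** If [d] or [e] coincides with [a], [b] or [c], a disjunct holds at once, so the content lies in
    the case of five distinct vertices. *)
Definition p3p2_free (G : sgraph) := forall a b c d e : G,
  adj a b -> adj b c -> a != c -> ~~ adj a c -> adj d e ->
  [|| adj a d, adj a e, adj b d, adj b e, adj c d | adj c e].

Definition w4_free (G : sgraph) := forall v a b c d : G,
  adj v a -> adj v b -> adj v c -> adj v d ->
  adj a b -> adj b c -> adj c d -> adj d a ->
  a != c -> b != d -> adj a c || adj b d.

Section Free.
Variable G : sgraph.

Lemma adj_neq (x y : G) : adj x y -> x != y.
Proof. by apply: contraTneq => ->; rewrite adj_irrefl. Qed.

Lemma free_p3p2 : free (disjoint_union (path_graph 3) (path_graph 2)) G -> p3p2_free G.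
Proof.
move=> frG a b c d e ab bc ac nac de; apply/negPn/negP.
rewrite !negb_or => /and5P[/negPf ad /negPf ae /negPf bd /negPf be /andP[/negPf cd /negPf ce]].
move/negPf: nac => nac.
(* Vertices differ if only one of them is adjacent to [y]; this separates the path from the edge. *)
have nx (x y z : G) : adj x y = false -> adj z y -> x != z.
  by move=> xy zy; apply: contraFneq xy => ->.
have ed : adj e d by rewrite adj_sym.
pose s := [:: a; b; c; d; e].
have us : uniq s.
  have E1 := (nx _ _ _ ae de, nx _ _ _ ad ed, nx _ _ _ be de, nx _ _ _ bd ed,
              nx _ _ _ ce de, nx _ _ _ cd ed).
  by rewrite /s /= !inE !negb_or ac !E1 !adj_neq.
pose code (x : disjoint_union (path_graph 3) (path_graph 2)) : nat :=
  match x with inl i => i | inr i => 3 + i end.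
have code5 x : code x < size s.
  by case: x => -[i lt_i]; [apply: leq_trans lt_i _ | rewrite -[size s]/(3 + 2) ltn_add2l].
apply: (@free_embedding _ _ (fun x => nth a s (code x)) frG).
  move=> x y /eqP; rewrite nth_uniq ?code5 // => /eqP.
  case: x y => x [] y /= e1.
  - by congr inl; apply: val_inj.
  - by have := ltn_ord x; rewrite e1 ltnNge leq_addr.
  - by have := ltn_ord y; rewrite -e1 ltnNge leq_addr.
  - by congr inr; apply: val_inj; apply: (@addnI 3).
move=> [[[|[|[|//]]] i]|[[|[|//]] i]] [[[|[|[|//]]] j]|[[|[|//]] j]];
  first [apply: (@etrans _ _ true); last by [] | apply: (@etrans _ _ false); last by []];
  rewrite /=; first [exact: adj_irrefl | assumption | rewrite adj_sym; assumption].
Qed.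

Lemma free_w4 : free wheel4 G -> w4_free G.
Proof.
move=> frG v a b c d va vb vc vd ab bc cd da ac bd; apply/negPn/negP.
rewrite negb_or => /andP[/negPf nac /negPf nbd].
pose s := [:: v; a; b; c; d].
have us : uniq s.
  by rewrite /s /= !inE !negb_or ac bd !adj_neq // adj_sym.
pose code (x : wheel4) : nat := match x with inl _ => 0 | inr i => i.+1 end.
have code5 x : code x < size s by case: x => -[i lt_i].
apply: (@free_embedding _ _ (fun x => nth v s (code x)) frG).
  move=> x y /eqP; rewrite nth_uniq ?code5 // => /eqP.
  case: x y => x [] y //= e1; first by rewrite (ord1 x) (ord1 y).
  by congr inr; apply: val_inj; case: e1.
move=> [[[|//] i]|[[|[|[|[|//]]]] i]] [[[|//] j]|[[|[|[|[|//]]]] j]];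
  first [apply: (@etrans _ _ true); last by [] | apply: (@etrans _ _ false); last by []];
  rewrite /=; first [exact: adj_irrefl | assumption | rewrite adj_sym; assumption].
Qed.
End Free.

(** * Types over a maximum clique *)

(* Running [lia] on a full context of set expressions is prohibitively slow. *)
Ltac card_lia :=
  repeat match goal with
  | H : is_true (leq _ _) |- _ => revert H
  | H : is_true (andb (leq _ _) (leq _ _)) |- _ => revert H
  | H : is_true (@eq_op Datatypes_nat__canonical__eqtype_Equality _ _) |- _ => revert H
  | H : is_true (negb (@eq_op Datatypes_nat__canonical__eqtype_Equality _ _)) |- _ => revert H
  | H : @eq ?T ?a ?b |- _ =>
      let T' := eval hnf in T in
      constr_eq T' nat; change (@eq nat a b) in H; revert H
  end;
  clear;
  repeat match goal with |- context [ #|?X| ] => generalize #|X| end;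
  lia.

Section Clique.
Variable G : sgraph.
Implicit Types (A B F K Q X : {set G}) (x y : G).

Lemma cliqueP A :
  reflect {in A &, forall x y, x != y -> adj x y} (clique A).
Proof.
apply: (iffP forall_inP) => [h x y xA yA|h x xA].
  by have /forall_inP/(_ y yA)/implyP := h x xA.
by apply/forall_inP=> y yA; apply/implyP; apply: h.
Qed.

Lemma cliqueU A B : clique A -> clique B ->
  {in A & B, forall x y, adj x y} -> clique (A :|: B).
Proof.
move=> /cliqueP cA /cliqueP cB AB; apply/cliqueP=> x y.
rewrite !inE => /orP[xA|xB] /orP[yA|yB] xy.
- exact: cA.
- exact: AB.
- by rewrite adj_sym AB.
- exact: cB.
Qed.

Lemma clique_sub A B : A \subset B -> clique B -> clique A.
Proof.
move=> /subsetP AB /cliqueP cB; apply/cliqueP=> x y /AB xB /AB yB; exact: cB.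
Qed.

(** Equivalently, the components of the graph induced on [B] are cliques. *)
Definition p3_free B := forall x y z, x \in B -> y \in B -> z \in B ->
  adj x y -> adj y z -> x != z -> adj x z.

Definition max_clique K := clique K /\ forall A, clique A -> #|A| <= #|K|.

Definition nbrs K x := [set k in K | adj k x].

Lemma in_nbrs K x k : (k \in nbrs K x) = (k \in K) && adj k x.
Proof. by rewrite inE. Qed.

Lemma nbrs_sub K x : nbrs K x \subset K.
Proof. by apply/subsetP=> k; rewrite inE => /andP[]. Qed.

Variable K : {set G}.
Hypothesis maxK : max_clique K.
Local Notation S := (nbrs K).

Lemma clique_common A X : clique A -> [disjoint A & K] ->
  {in A, forall x, X \subset S x} -> X \subset K -> #|A| + #|X| <= #|K|.
Proof.
case: maxK => cK mK cA dAK AX XK.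
have cAX : clique (A :|: X).
  apply: cliqueU => //; first exact: clique_sub cK.
  by move=> x k xA kX; have /subsetP/(_ k kX) := AX x xA; rewrite inE adj_sym => /andP[].
have := mK _ cAX; rewrite cardsU.
suff -> : A :&: X = set0 by rewrite cards0 subn0.
apply/eqP; rewrite setI_eq0; apply: disjointWr dAK; exact: XK.
Qed.

Lemma nbrs_proper x : x \notin K -> #|S x| < #|K|.
Proof.
move=> xK; have := @clique_common [set x] (S x); rewrite cards1 => h; apply: h.
- by apply/cliqueP=> y z; rewrite !inE => /eqP-> /eqP->; rewrite eqxx.
- by rewrite disjoints1.
- by move=> y /set1P->.
- exact: nbrs_sub.
Qed.

(* Each component of [B] is a clique [Q]; a system of distinct representatives
   of the sets [K :\: S x], [x \in Q], colours it with the colours of [K]. *)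
Lemma col_p3_free B : [disjoint B & K] -> p3_free B -> col (K :|: B) #|K|.
Proof.
move=> dBK pB.
have BK x : x \in B -> x \notin K by move=> xB; rewrite (disjointFr dBK).
pose comp x := [set y in B | (y == x) || adj x y].
pose good Q (g : {ffun G -> G}) :=
  [forall x in Q, (g x \in K :\: S x) && [forall y in Q, (g x == g y) ==> (x == y)]].
have ex_good x : x \in B -> exists g, good (comp x) g.
  move=> xB.
  have cC : clique (comp x).
    apply/cliqueP=> y z; rewrite !inE => /andP[yB /orP[/eqP->|xy]] /andP[zB /orP[/eqP->|xz]] yz.
    - by rewrite eqxx in yz.
    - by [].
    - by rewrite adj_sym.
    - by apply: (pB y x z) => //; rewrite adj_sym.
  have [Y YC|f injf fA] := @hall G (fun y => K :\: S y) (comp x).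
    have [->|Y0] := set_0Vmem Y; first by rewrite cards0.
    case: Y0 => y0 y0Y.
    (* [X] is the set of common neighbours of [Y] in [K], so Hall's condition for [Y] is the bound
       of [clique_common]. *)
    pose X := K :\: \bigcup_(y in Y) (K :\: S y).
    have : #|Y| + #|X| <= #|K|.
      apply: clique_common.
      - exact: clique_sub cC.
      - rewrite disjoint_subset; apply/subsetP=> y /(subsetP YC).
        by rewrite !inE => /andP[/BK].
      - move=> y yY; apply/subsetP=> k; rewrite inE => /andP[/bigcupP kN kK].
        apply/negPn/negP=> kS; case: kN; exists y => //; by rewrite inE kS kK.
      - exact: subsetDl.
    rewrite cardsD; have := subset_leq_card (subsetIr K (\bigcup_(y in Y) (K :\: S y))).
    have := subset_leq_card (subsetIl K (\bigcup_(y in Y) (K :\: S y))).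
    card_lia.
  exists [ffun y => f y]; apply/forall_inP=> y yC; rewrite !ffunE fA //=.
  apply/forall_inP=> z zC; rewrite ffunE; apply/implyP=> /eqP fyz.
  by rewrite (injf y z).
(* The choice depends on [comp x] alone, so the vertices of a component share one system of
   representatives. The default is never reached for [x] in [B]. *)
pose g x := odflt [ffun y => y] [pick g | good (comp x) g].
have goodg x : x \in B -> good (comp x) (g x).
  move=> xB; rewrite /g; case: pickP => [//|none].
  by case: (ex_good x xB) => h; rewrite none.
have compx x : x \in B -> x \in comp x by move=> xB; rewrite inE xB eqxx.
have gK x : x \in B -> g x x \in K :\: S x.
  by move=> xB; have /forall_inP/(_ x (compx x xB))/andP[] := goodg x xB.
pose c x := if x \in K then x else g x x.
have cK x : x \in K :|: B -> c x \in K.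
  rewrite /c inE; case: ifP => //= _ /gK; by rewrite inE => /andP[].
exists (fun x => index (c x) (enum K)) => [x /cK xK|x y xKB yKB xy].
  by rewrite cardE index_mem mem_enum.
have cxy : c x != c y.
  move: xKB yKB; rewrite /c !inE; case: ifP => xK; case: ifP => yK //= xB yB.
  - by apply: contraTneq xy => ->; rewrite adj_irrefl.
  - have := gK y yB; rewrite !inE => /andP[+ kK]; rewrite kK /=.
    by apply: contraNneq => <-.
  - have := gK x xB; rewrite !inE => /andP[+ kK]; rewrite kK /=.
    by apply: contraNneq => ->; rewrite adj_sym.
  - have Cxy : comp x = comp y.
      apply/setP=> z; rewrite !inE; case zB: (z \in B) => //=.
      have [->|zx] := eqVneq z x; first by rewrite adj_sym xy orbT.
      have [->|zy] := eqVneq z y; first by rewrite xy.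
      apply/idP/idP=> /= zz.
        by apply: (pB y x z) => //; rewrite 1?adj_sym // eq_sym.
      by apply: (pB x y z) => //; rewrite eq_sym.
    have /forall_inP/(_ x (compx x xB))/andP[_ /forall_inP] := goodg x xB.
    rewrite {1}Cxy => /(_ y (compx y yB)).
    have -> : g y = g x by rewrite /g Cxy.
    move/implyP=> h; apply/negP=> /h /eqP exy.
    by rewrite exy adj_irrefl in xy.
apply: contraNneq cxy => exy; apply/eqP.
by rewrite -(@nth_index _ x (c x) (enum K)) ?mem_enum ?cK // exy nth_index ?mem_enum ?cK.
Qed.

Hypothesis p3p2 : p3p2_free G.
Hypothesis w4 : w4_free G.

(** Otherwise take [i] in [S x] only, [j] in [S y] only and [k] in both: [k] is the hub over the
    induced 4-cycle [i], [j], [y], [x]. *)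
Lemma nested_or_disjoint x y : x \notin K -> y \notin K -> adj x y ->
  [|| S x \subset S y, S y \subset S x | [disjoint S x & S y]].
Proof.
case: maxK => /cliqueP cK _ xK yK xy; apply/negPn/negP; rewrite !negb_or => /and3P[].
move=> /subsetPn[i]; rewrite !inE => /andP[iK ix]; rewrite iK /= => niy.
move=> /subsetPn[j]; rewrite !inE => /andP[jK jy]; rewrite jK /= => njx.
rewrite -setI_eq0 => /set0Pn[k]; rewrite !inE => /andP[/andP[kK kx] /andP[_ ky]].
have ki : adj k i by apply: cK => //; apply: contraNneq niy => <-.
have kj : adj k j by apply: cK => //; apply: contraNneq njx => <-.
have ij : adj i j by apply: cK => //; apply: contraNneq niy => ->.
have iy : i != y by apply: contraNneq yK => <-.
have jx : j != x by apply: contraNneq xK => <-.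
have := w4 ki kj ky kx ij jy _ _ iy jx.
rewrite adj_sym xy adj_sym ix => /(_ isT isT).
by rewrite (negPf niy) (negPf njx).
Qed.

(** If [x] and [z] were not adjacent, the path [x], [y], [z] and an edge of [K] outside [X] would
    form an induced P3 u P2. *)
Lemma p3_cover X x y z : S x \subset X -> S y \subset X -> S z \subset X ->
  1 < #|K :\: X| -> adj x y -> adj y z -> x != z -> adj x z.
Proof.
case: maxK => /cliqueP cK _ /subsetP xX /subsetP yX /subsetP zX /card_gt1P[i [j [iX jX ij]]] xy yz xz.
move: iX jX; rewrite !inE => /andP[iX iK] /andP[jX jK].
apply/negPn/negP=> nxz.
have nadj k v : k \in K -> k \notin X -> (forall m, m \in S v -> m \in X) -> adj v k = false.
  move=> kK kX vX; apply: contraNF kX => vk; apply: vX; rewrite inE kK adj_sym; exact: vk.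
have := p3p2 xy yz xz nxz (cK _ _ iK jK ij).
by rewrite !nadj.
Qed.

(** Here [K] helps to supply the path: [z], [i], [j] is an induced P3, and the edge [x y] can only
    be joined to it at [z]. *)
Lemma edge_cross x y z i j : adj x y -> z \notin K ->
  i \in S z -> i \notin S x -> i \notin S y ->
  j \in K -> j \notin S x -> j \notin S y -> j \notin S z ->
  adj x z || adj y z.
Proof.
case: maxK => /cliqueP cK _; rewrite !inE => xy zK /andP[iK iz]; rewrite iK /= => nix niy jK.
rewrite jK /= => njx njy njz.
have ij : adj i j by apply: cK => //; apply: contraNneq njz => <-.
have zj : z != j by apply: contraNneq zK => ->.
have zi : adj z i by rewrite adj_sym.
have nzj : ~~ adj z j by rewrite adj_sym.
have := p3p2 zi ij zj nzj xy.
by rewrite (negPf nix) (negPf niy) (negPf njx) (negPf njy) /= orbF !(adj_sym z).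
Qed.

Definition almost := [set x | (x \notin K) && (#|S x| == #|K|.-1)].
Definition deep := [set x | (x \notin K) && (#|S x| + 2 <= #|K|)].

(** Two disjoint types of size w - 1 do not fit into [K], so adjacent members would have equal types
    and form with that type a clique of size w + 1. *)
Lemma almost_stable : 2 < #|K| -> stable almost.
Proof.
move=> K3 x y; rewrite !inE => /andP[xK /eqP Sx] /andP[yK /eqP Sy]; apply/negP=> xy.
have Sxy : S x = S y.
  have := nested_or_disjoint xK yK xy; case/or3P=> [h|h|h].
  - by apply/eqP; rewrite eqEcard h Sx Sy leqnn.
  - by apply/esym/eqP; rewrite eqEcard h Sx Sy leqnn.
  - have : #|S x :|: S y| <= #|K| by apply: subset_leq_card; rewrite subUset !nbrs_sub.
    by rewrite cardsU; move: h; rewrite -setI_eq0 => /eqP->; rewrite cards0; card_lia.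
have := @clique_common [set x; y] (S x).
have nxy := adj_neq xy.
rewrite cards2 nxy /= => h.
suff : 2 + #|S x| <= #|K| by card_lia.
apply: h.
- apply/cliqueP=> u v; rewrite !inE => /orP[]/eqP-> /orP[]/eqP->; rewrite ?eqxx //.
  by rewrite adj_sym.
- rewrite disjoint_subset; apply/subsetP=> v; rewrite !inE.
  by case/orP=> /eqP->.
- by move=> v; rewrite !inE => /orP[]/eqP->; rewrite ?Sxy.
- exact: nbrs_sub.
Qed.

Lemma vertex_cover : K :|: almost :|: deep = setT.
Proof.
apply/setP=> x; rewrite !inE; case xK: (x \in K) => //=.
have := nbrs_proper (negbT xK); card_lia.
Qed.

(* With nested types, the neighbours of [x] of type contained in [S x] form a
   clique with [x], complete to the smallest of these types. *)
Lemma col_nested F a : F \subset deep -> {in F, forall x, a <= #|S x|} ->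
  {in F &, forall x y, adj x y -> (S x \subset S y) || (S y \subset S x)} ->
  col F (#|K| - a).
Proof.
move=> /subsetP FD aF nF; apply: col_degenerate => B /subsetP BF B0.
have [x0 x0B] := set0Pn _ B0.
(* A largest type in [B] contains the types of all neighbours in [B], so [x] is the low-degree
   vertex for the greedy colouring. *)
case: (@arg_maxnP _ x0 (mem B) (fun x => #|S x|) x0B) => x xB xmax.
exists x => //; set Y := [set y in B | adj x y].
have SY y : y \in Y -> S y \subset S x.
  rewrite inE => /andP[yB xy]; have /orP[h|//] := nF _ _ (BF _ xB) (BF _ yB) xy.
  have : S x == S y by rewrite eqEcard h; apply: xmax.
  by move/eqP->.
have xD := FD _ (BF _ xB); move: (xD); rewrite inE => /andP[xK Sx].
have Kx : 1 < #|K :\: S x|.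
  by rewrite cardsD; move/setIidPr: (nbrs_sub K x) => ->; card_lia.
have cY : clique (x |: Y).
  apply/cliqueP=> y z; rewrite !in_setU1 => /predU1P[->|yY] /predU1P[->|zY] yz.
  - by rewrite eqxx in yz.
  - by move: zY; rewrite inE => /andP[].
  - by move: yY; rewrite inE adj_sym => /andP[].
  - apply: (p3_cover (SY y yY) (subxx _) (SY z zY) Kx) => //.
      by move: yY; rewrite inE adj_sym => /andP[].
    by move: zY; rewrite inE => /andP[].
case: (@arg_minnP _ x (mem (x |: Y)) (fun x => #|S x|)); first by rewrite /= setU11.
move=> m mY mmin.
have YB y : y \in x |: Y -> y \in B.
  by rewrite in_setU1 => /predU1P[->//|]; rewrite inE => /andP[].
have : #|x |: Y| + #|S m| <= #|K|.
  apply: clique_common => //.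
  - rewrite disjoint_subset; apply/subsetP=> y /YB /BF /FD.
    by rewrite !inE => /andP[].
  - move=> y yY; have [->//|my] := eqVneq m y.
    have cmy : adj m y by move/cliqueP: cY; apply.
    have /orP[//|h] := nF _ _ (BF _ (YB _ mY)) (BF _ (YB _ yY)) cmy.
    have : S y == S m by rewrite eqEcard h; apply: mmin.
    by move/eqP->.
  - exact: nbrs_sub.
have am := aF _ (BF _ (YB _ mY)).
rewrite cardsU1; have -> : x \notin Y by rewrite inE adj_irrefl andbF.
card_lia.
Qed.

End Clique.

(** * Splitting along a nested edge *)

Lemma below3_pairs a b d e f : a < 3 -> b < 3 -> d < 3 -> e < 3 -> f < 3 ->
  a != b -> a != d -> b != d -> e != f ->
  [|| (e == a) && (f == b), (e == b) && (f == a), (e == a) && (f == d),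
      (e == d) && (f == a), (e == b) && (f == d) | (e == d) && (f == b)].
Proof.
by move: a b d e f => [|[|[|//]]] [|[|[|//]]] [|[|[|//]]] [|[|[|//]]] [|[|[|//]]].
Qed.

(** Two pairs out of three classes share a class; in [split_three] this aligns two disjoint
    nonedges. *)
Lemma below3_meet a b c d : a < 3 -> b < 3 -> c < 3 -> d < 3 -> a != b -> c != d ->
  [|| (a == c) && (b != d), (a == d) && (b != c), (b == c) && (a != d),
      (b == d) && (a != c), (a == c) && (b == d) | (a == d) && (b == c)].
Proof. by move: a b c d => [|[|[|//]]] [|[|[|//]]] [|[|[|//]]] [|[|[|//]]]. Qed.

(* [Y] is a split graph: the nonedges join different classes of [t], at most one
   of them joins two given classes, and disjoint nonedges are linked by a third one. *)
Lemma split_three (G : sgraph) (Y : {set G}) (t : G -> nat) :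
  {in Y, forall y, t y < 3} ->
  {in Y &, forall x y, t x = t y -> x != y -> adj x y} ->
  {in Y & Y & Y, forall a b v, t a = t b -> a != b -> t v != t a ->
     adj a v || adj b v} ->
  (forall a b c d, a \in Y -> b \in Y -> c \in Y -> d \in Y ->
     adj a b -> adj b c -> adj c d -> adj d a -> a != c -> b != d ->
     adj a c || adj b d) ->
  exists I : {set G}, [/\ I \subset Y, stable I & clique (Y :\: I)].
Proof.
move=> t3 same miss C4.
pose ne a b := [&& a \in Y, b \in Y, a != b & ~~ adj a b].
have neC a b : ne a b -> ne b a.
  by case/and4P=> aY bY ab nab; rewrite /ne aY bY eq_sym ab adj_sym nab.
have ne_t a b : ne a b -> t a != t b.
  by case/and4P=> aY bY ab; apply: contraNneq => /same; apply.
have adj_or a b : a \in Y -> b \in Y -> a != b -> adj a b \/ ne a b.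
  by move=> aY bY ab; rewrite /ne aY bY ab; case: (adj a b); auto.
(* By [miss], a vertex has at most one non-neighbour in each class. *)
have uniq2 a b c : ne a b -> ne a c -> t b = t c -> b = c.
  move=> nab nac bc; apply/eqP/negPn/negP=> bc'.
  case/and4P: (nab) => aY bY _ /negPf ab; case/and4P: (nac) => _ cY _ /negPf ac.
  have := miss b c a bY cY aY bc bc' (ne_t _ _ nab).
  by rewrite !(adj_sym _ a) ab ac.
(* If [b] and [d] were adjacent, [a], [c], [b], [d] would be a 4-cycle whose diagonals are the
   nonedges [a b] and [c d]. *)
have link a b c d : ne a b -> ne c d -> t a = t c -> b != d -> a = c \/ ne b d.
  move=> nab ncd ac bd; case: (eqVneq a c) => [->|aNc]; [by left | right].
  case/and4P: (nab) => aY bY ab /negPf nadj_ab; case/and4P: (ncd) => cY dY cd /negPf nadj_cd.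
  case: (adj_or b d) => // adj_bd.
  have adj_ac : adj a c by apply: same.
  have adj_ad : adj a d.
    case: (adj_or a d) => //; first by apply: contraNneq (ne_t _ _ ncd) => <-; apply/eqP.
    by move=> /neC nda; case/eqP: aNc; apply: (uniq2 d) => //; apply: neC.
  have adj_cb : adj c b.
    case: (adj_or c b) => //; first by apply: contraNneq (ne_t _ _ nab) => <-; apply/eqP.
    by move=> /neC nbc; case/eqP: aNc; apply: (uniq2 b) => //; apply: neC.
  have := C4 a c b d aY cY bY dY adj_ac adj_cb adj_bd _ ab cd.
  by rewrite adj_sym adj_ad nadj_ab nadj_cd => /(_ isT).
have uniq a b c d : ne a b -> ne c d -> t a = t c -> t b = t d -> a = c /\ b = d.
  move=> nab ncd ac bd; have [ebd|bNd] := eqVneq b d.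
    by subst d; split=> //; apply: (uniq2 b); rewrite // neC.
  case: (link a b c d nab ncd ac bNd) => [eac|/ne_t]; last by rewrite bd eqxx.
  by subst c; split=> //; apply: (uniq2 a).
have cover (I : {set G}) : I \subset Y -> stable I ->
    (forall c d, ne c d -> (c \in I) || (d \in I)) ->
    exists I : {set G}, [/\ I \subset Y, stable I & clique (Y :\: I)].
  move=> IY sI cI; exists I; split=> //; apply/cliqueP=> x y.
  rewrite !inE => /andP[xI xY] /andP[yI yY] xy; case: (adj_or x y) => // /cI.
  by rewrite (negPf xI) (negPf yI).
have pair a b : ne a b -> [set a; b] \subset Y /\ stable [set a; b].
  case/and4P=> aY bY ab nab; split.
    by apply/subsetP=> x; rewrite !inE => /orP[]/eqP->.
  by move=> x y; rewrite !inE => /orP[]/eqP-> /orP[]/eqP->; rewrite ?adj_irrefl // adj_sym.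
(* The nonedges [a b], [c d] and, by [link], [b d] use up the three pairs of classes. By [uniq]
   there are no others, and [[set b; d]] meets all three. *)
have three a b c d : ne a b -> ne c d -> t a = t c -> t b != t d -> a != c ->
    exists I : {set G}, [/\ I \subset Y, stable I & clique (Y :\: I)].
  move=> nab ncd ac bd aNc.
  have bNd : b != d by apply: contraNneq bd => ->.
  case: (link a b c d nab ncd ac bNd) => [/eqP|nbd]; first by rewrite (negPf aNc).
  have [bdY sbd] := pair _ _ nbd.
  apply: (cover _ bdY sbd) => e f nef; rewrite !inE.
  have ad : t a != t d by rewrite ac ne_t.
  case/and4P: (nab) => aY bY _ _; case/and4P: (ncd) => _ dY _ _; case/and4P: (nef) => eY fY _ _.
  have tE := below3_pairs (t3 a aY) (t3 b bY) (t3 d dY) (t3 e eY) (t3 f fY)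
               (ne_t _ _ nab) ad bd (ne_t _ _ nef).
  have nfe := neC _ _ nef.
  case/orP: tE => [/andP[/eqP e1 /eqP e2]|]; first by case: (uniq _ _ _ _ nef nab e1 e2) => _ ->; rewrite eqxx ?orbT.
  case/orP=> [/andP[/eqP e1 /eqP e2]|]; first by case: (uniq _ _ _ _ nfe nab e2 e1) => _ ->; rewrite eqxx ?orbT.
  rewrite {1 2}ac.
  case/orP=> [/andP[/eqP e1 /eqP e2]|]; first by case: (uniq _ _ _ _ nef ncd e1 e2) => _ ->; rewrite eqxx ?orbT.
  case/orP=> [/andP[/eqP e1 /eqP e2]|]; first by case: (uniq _ _ _ _ nfe ncd e2 e1) => _ ->; rewrite eqxx ?orbT.
  case/orP=> [/andP[/eqP e1 /eqP e2]|/andP[/eqP e1 /eqP e2]].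
    by case: (uniq _ _ _ _ nef nbd e1 e2) => _ ->; rewrite eqxx ?orbT.
  by case: (uniq _ _ _ _ nfe nbd e2 e1) => _ ->; rewrite eqxx ?orbT.
(* Either there is no nonedge, or the ends of one nonedge meet all the others, or two nonedges are
   disjoint and [three] applies. *)
case: (boolP [exists a, [exists b, ne a b]]) => [/existsP[a /existsP[b nab]]|none].
  have [abY sab] := pair _ _ nab.
  case: (boolP [exists c, [exists d, [&& ne c d, c \notin [set a; b] & d \notin [set a; b]]]]).
    case/existsP=> c /existsP[d /and3P[ncd]]; rewrite !inE !negb_or.
    case/andP=> ca cb /andP[da db].
    case/and4P: (nab) => aY bY _ _; case/and4P: (ncd) => cY dY _ _.
    have tE := below3_meet (t3 a aY) (t3 b bY) (t3 c cY) (t3 d dY) (ne_t _ _ nab) (ne_t _ _ ncd).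
    have nba := neC _ _ nab; have ndc := neC _ _ ncd.
    case/orP: tE => [/andP[/eqP e1 e2]|]; first by apply: (three a b c d) => //; rewrite eq_sym.
    case/orP=> [/andP[/eqP e1 e2]|]; first by apply: (three a b d c) => //; rewrite eq_sym.
    case/orP=> [/andP[/eqP e1 e2]|]; first by apply: (three b a c d) => //; rewrite eq_sym.
    case/orP=> [/andP[/eqP e1 e2]|]; first by apply: (three b a d c) => //; rewrite eq_sym.
    case/orP=> [/andP[/eqP e1 /eqP e2]|/andP[/eqP e1 /eqP e2]].
      by case: (uniq _ _ _ _ nab ncd e1 e2) => e; rewrite e eqxx in ca.
    by case: (uniq _ _ _ _ nab ndc e1 e2) => e; rewrite e eqxx in da.
  move=> none; apply: (cover _ abY sab) => c d ncd; apply: contraNT none.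
  by rewrite negb_or => /andP[cN dN]; apply/existsP; exists c; apply/existsP; exists d; rewrite ncd cN.
apply: (cover set0); [exact: sub0set | by move=> x y; rewrite inE | move=> c d ncd].
by case/negP: none; apply/existsP; exists c; apply/existsP; exists d.
Qed.

Section Base.
Variable G : sgraph.
Hypothesis p3p2 : p3p2_free G.
Hypothesis w4 : w4_free G.
Variable K : {set G}.
Hypothesis maxK : max_clique K.
Local Notation S := (nbrs K).
Local Notation D := (deep K).

(** The account for the whole proof: |K| colours for [K :|: B], one for the almost vertices, |K| - 1
    for the remainder [R]. *)
Lemma col_budget (B R : {set G}) : 2 < #|K| -> B \subset D -> p3_free B ->
  D \subset B :|: R -> col R (#|K| - 1) -> col [set: G] (2 * #|K|).
Proof.
move=> K3 BD pB DBR cR.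
have dBK : [disjoint B & K].
  rewrite disjoint_subset; apply/subsetP=> x /(subsetP BD).
  by rewrite !inE => /andP[].
have c1 := col_p3_free maxK dBK pB.
have c2 := col_stable (almost_stable maxK w4 K3).
apply: col_sub (col_union (col_union c1 c2) cR); last card_lia.
rewrite -(vertex_cover maxK) !subUset -andbA; apply/and3P; split.
- by rewrite -!setUA subsetUl.
- by apply: subset_trans (subsetUl _ _); apply: subsetUr.
- apply: subset_trans DBR _; rewrite subUset subsetUr andbT.
  by rewrite -!setUA (subset_trans _ (subsetUr _ _)) // subsetUl.
Qed.

Variables u w : G.
Hypotheses (wD : w \in D) (uw : adj u w) (Suw : S u \subset S w).
Hypothesis topw : #|S w| + 3 <= #|K|.
Hypothesis maxw : {in D &, forall x y, adj x y -> S x \subset S y ->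
  #|S y| + 3 <= #|K| -> #|S y| <= #|S w|}.

Local Notation T := (S w).
Variable n : nat.
Hypothesis nE : #|K| = #|T| + n.
Let tr y := S y :\: T.
Let B0 := [set x in D | S x \subset T].
(** A trace of this size is nonempty and misses an edge of [K :\: T], as needed for [edge_cross] and
    [p3_cover]. *)
Let Y := [set y in D | 0 < #|tr y| <= n - 2].

Let cardU : #|K :\: T| = n.
Proof. by rewrite cardsD; move/setIidPr: (nbrs_sub K w) => ->; rewrite nE addKn. Qed.

Let tr_sub y : tr y \subset K :\: T.
Proof. by apply: setSD; apply: nbrs_sub. Qed.

Let missD X : #|K :\: (T :|: X)| = n - #|(K :&: X) :\: T|.
Proof.
rewrite setDUr -cardU.
have -> : (K :\: T) :&: (K :\: X) = (K :\: T) :\: ((K :&: X) :\: T).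
  by apply/setP=> k; rewrite !inE; case: (k \in K); case: (adj k w); case: (k \in X).
rewrite cardsD; congr (_ - #|pred_of_set _|); apply/setIidPr.
by apply: setSD; apply: subsetIl.
Qed.

Let KS y : K :&: S y = S y.
Proof. by apply/setIidPr; apply: nbrs_sub. Qed.

Let YD y : y \in Y -> y \in D. Proof. by rewrite inE => /andP[]. Qed.
Let DK y : y \in D -> y \notin K. Proof. by rewrite inE => /andP[]. Qed.

Let miss y : y \in Y -> 1 < #|K :\: (T :|: S y)|.
Proof. by rewrite inE => /and3P[_ y0 yn]; rewrite missD KS -/(tr y); card_lia. Qed.

(** [edge_cross] makes [y] adjacent to [u] or to [w]; in the first case the path [y], [u], [w] is
    closed by [p3_cover]. *)
Let Yw y : y \in Y -> adj y w.
Proof.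
move=> yY; have yK := DK (YD yY).
have [i] : exists i, i \in tr y.
  by apply/set0Pn; rewrite -card_gt0; move: yY; rewrite inE => /and3P[].
rewrite in_setD => /andP[iT iy].
have [j] : exists j, j \in K :\: (T :|: S y).
  by apply/set0Pn; rewrite -card_gt0; have := miss yY; card_lia.
rewrite in_setD in_setU negb_or => /andP[/andP[jT jy] jK].
have iu : i \notin S u by apply: contraNN iT; apply: (subsetP Suw).
have ju : j \notin S u by apply: contraNN jT; apply: (subsetP Suw).
have /orP[uy|] := edge_cross maxK p3p2 uw yK iy iu iT jK ju jT jy; last by rewrite adj_sym.
apply: (p3_cover maxK p3p2 (y := u) _ _ _ (miss yY)) => //.
- exact: subsetUr.
- by apply: subset_trans Suw _; apply: subsetUl.
- exact: subsetUl.
- by rewrite adj_sym.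
- apply: contraTneq yY => ->; rewrite inE.
  by have -> : tr w = set0 by [rewrite /tr setDv]; rewrite cards0 andbF.
Qed.

(** The types of [y] and [w] are nested, and the nonempty trace makes T the smaller one. Maximality
    of T then leaves only the size |K| - 2. *)
Let Ynested y : y \in Y -> S y :&: T != set0 -> T \subset S y /\ #|S y| + 2 = #|K|.
Proof.
move=> yY yT; have yD := YD yY.
have yw := Yw yY; have := nested_or_disjoint maxK w4 (DK yD) (DK wD) yw.
rewrite -setI_eq0 (negPf yT) orbF => /orP[h|h].
  by move: yY; rewrite inE /tr; move: h; rewrite -setD_eq0 => /eqP->; rewrite cards0 andbF.
split=> //.
have Syw : #|S y| = #|T| + #|tr y|.
  by rewrite -(cardsID T (S y)) (setIidPr h).
have := maxw wD yD; rewrite adj_sym yw h => /(_ isT isT).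
move: yY yD; rewrite !inE => /and3P[_ y0 _] /andP[_ yD]; card_lia.
Qed.

(** The path [x], [w], [y] has types that together miss two vertices of [K]. *)
Let Ycover x y : x \in Y -> y \in Y -> x != y -> #|tr x :|: tr y| < n - 1 -> adj x y.
Proof.
move=> xY yY xy lt_n.
apply: (p3_cover maxK p3p2 (y := w) (X := T :|: (S x :|: S y))) => //.
- by rewrite setUCA subsetUl.
- exact: subsetUl.
- by rewrite setUA subsetUr.
- rewrite missD setIUr !KS setDUl -/(tr x) -/(tr y).
  by have := subset_leq_card (subsetUl (tr x) (tr y)); card_lia.
- exact: Yw.
- by rewrite adj_sym Yw.
Qed.

(** Adjacency is carried along [w]: the path [x], [y], [w] gives the edge [x w], then [x], [w], [z]
    gives [x z]. *)
Let B0w x y : x \in B0 -> y \in Y -> adj x y -> {in Y, forall z, adj x z}.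
Proof.
rewrite inE => /andP[xD xT] yY xy z zY.
have [->|xNw] := eqVneq x w; first by rewrite adj_sym Yw.
have xw : adj x w.
  apply: (p3_cover maxK p3p2 (y := y) _ _ _ (miss yY)) => //.
  - by apply: subset_trans xT _; apply: subsetUl.
  - exact: subsetUr.
  - exact: subsetUl.
  - exact: Yw.
apply: (p3_cover maxK p3p2 (y := w) _ _ _ (miss zY)) => //.
- by apply: subset_trans xT _; apply: subsetUl.
- exact: subsetUl.
- exact: subsetUr.
- by rewrite adj_sym Yw.
- apply: contraTneq zY => <-; rewrite inE /tr.
  by move: xT; rewrite -setD_eq0 => /eqP->; rewrite cards0 andbF.
Qed.

(** Paths with at most one vertex in [M] are closed by [p3_cover], those with both ends in [M] by
    the clique, and the others by [B0w]. *)
Let p3_free_base (M : {set G}) : M \subset Y -> clique M -> p3_free (B0 :|: M).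
Proof.
move=> /subsetP MY /cliqueP cM x y z; rewrite !in_setU.
have sB v X : v \in B0 -> S v \subset T :|: X.
  by rewrite inE => /andP[_ h]; apply: subset_trans h _; apply: subsetUl.
have K2 : 1 < #|K :\: (T :|: set0)| by rewrite setU0 cardU; card_lia.
case/orP=> xB; case/orP=> yB; case/orP=> zB xy yz xz.
- by apply: (p3_cover maxK p3p2 (y := y) _ _ _ K2); auto.
- by apply: (p3_cover maxK p3p2 (y := y) _ _ _ (miss (MY _ zB))); auto using subsetUr.
- by apply: (p3_cover maxK p3p2 (y := y) _ _ _ (miss (MY _ yB))); auto using subsetUr.
- by apply: (B0w xB (MY _ yB)); auto.
- by apply: (p3_cover maxK p3p2 (y := y) _ _ _ (miss (MY _ xB))); auto using subsetUr.
- exact: cM.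
- by rewrite adj_sym; apply: (B0w zB (MY _ yB)); rewrite 1?adj_sym; auto.
- exact: cM.
Qed.

Let B0D : B0 \subset D. Proof. by apply/subsetP=> x; rewrite inE => /andP[]. Qed.
Let YDsub : Y \subset D. Proof. by apply/subsetP=> x /YD. Qed.

Let col_base (M R : {set G}) : M \subset Y -> clique M -> D \subset B0 :|: M :|: R ->
  col R (#|K| - 1) -> col [set: G] (2 * #|K|).
Proof.
move=> MY cM; apply: col_budget; first card_lia; last exact: p3_free_base.
by rewrite subUset B0D (subset_trans MY).
Qed.

Let tr_disjoint x y : [disjoint S x & S y] -> #|tr x| + #|tr y| <= n.
Proof.
move=> dxy; have dtr : tr x :&: tr y = set0.
  apply/eqP; rewrite setI_eq0; apply: disjointWl (subsetDl _ _) _.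
  exact: disjointWr (subsetDl _ _) dxy.
rewrite -cardU; have : #|tr x :|: tr y| <= #|K :\: T|.
  by apply: subset_leq_card; rewrite subUset !tr_sub.
by rewrite cardsU dtr cards0; card_lia.
Qed.

Let nested_card x y : x \notin K -> y \notin K -> adj x y -> #|S x| = #|S y| ->
  S x != S y -> [disjoint S x & S y].
Proof.
move=> xK yK xy cxy nxy; case/or3P: (nested_or_disjoint maxK w4 xK yK xy) => // h.
  by case/eqP: nxy; apply/eqP; rewrite eqEcard h cxy leqnn.
by case/eqP: nxy; apply/esym/eqP; rewrite eqEcard h cxy leqnn.
Qed.

Let tr0 y : #|tr y| = 0 -> y \in D -> y \in B0.
Proof. by move/cards0_eq/eqP; rewrite setD_eq0 => h yD; rewrite inE yD. Qed.

(** Traces of size at least 2 among three vertices meet, so [F] takes |K| - 2 colours. Singleton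
    traces give the classes of [split_three]: its clique joins the base, its stable set takes one
    more colour. *)
Lemma col_three : n = 3 -> col [set: G] (2 * #|K|).
Proof.
move=> n3; pose F := [set y in D | 1 < #|tr y|].
have tr1 y : y \in Y -> #|tr y| = 1.
  by rewrite inE n3 => /and3P[_]; card_lia.
have cF : col F (#|K| - 2).
  apply: (col_nested maxK p3p2).
  - by apply/subsetP=> x; rewrite inE => /andP[].
  - move=> x; rewrite inE => /andP[_ h].
    by have := subset_leq_card (subsetDl (S x) T); rewrite -/(tr x); card_lia.
  - move=> x y; rewrite inE => /andP[xD x2]; rewrite inE => /andP[yD y2] xy.
    have := nested_or_disjoint maxK w4 (DK xD) (DK yD) xy.
    by case/or3P => [->//|->|/tr_disjoint]; rewrite ?orbT //; card_lia.
pose t y := find (fun k => k \in S y) (enum (K :\: T)).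
have size3 : size (enum (K :\: T)) = 3 by rewrite -cardE cardU.
have has_t y : y \in Y -> has (fun k => k \in S y) (enum (K :\: T)).
  move=> yY; have [i] : exists i, i \in tr y.
    by apply/set0Pn; rewrite -card_gt0 tr1.
  move=> iy; apply/hasP; exists i; last by move: iy; rewrite in_setD => /andP[].
  by rewrite mem_enum; apply: (subsetP (tr_sub y)).
pose e y := nth y (enum (K :\: T)) (t y).
have trE y : y \in Y -> tr y = [set e y].
  move=> yY; have /eqP/cards1P[k kE] := tr1 y yY.
  suff : e y \in tr y by rewrite kE inE => /eqP <-.
  rewrite in_setD (nth_find y (has_t y yY)) andbT.
  have : e y \in K :\: T by rewrite -mem_enum mem_nth // -has_find has_t.
  by rewrite in_setD => /andP[].
have e_eq x y : x \in Y -> y \in Y -> (e x == e y) = (t x == t y).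
  move=> xY yY; rewrite /e (set_nth_default y) -?has_find ?has_t //.
  by rewrite nth_uniq ?enum_uniq // -has_find has_t.
have [I [IY sI cI]] : exists I : {set G}, [/\ I \subset Y, stable I & clique (Y :\: I)].
  apply: (@split_three _ _ t).
  - by move=> y yY; rewrite -size3 -has_find has_t.
  - move=> x y xY yY /eqP; rewrite -e_eq // => /eqP exy xy; apply: Ycover => //.
    by rewrite !trE // exy setUid cards1 n3.
  - move=> a b v aY bY vY /eqP; rewrite -e_eq // => /eqP eab ab; rewrite -e_eq // => eva.
    (* [e v] lies in the type of [v] only and [k] in none of the three, so [edge_cross] applies to
       the edge [a b]. *)
    have [k] : exists k, k \in (K :\: T) :\: [set e a; e v].
      apply/set0Pn; rewrite -card_gt0 cardsD cardU n3.
      have := subset_leq_card (subsetIr (K :\: T) [set e a; e v]).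
      by rewrite cards2; card_lia.
    rewrite in_setD in_set2 in_setD negb_or -andbA => /and4P[ka kv kT kK].
    have inS y l : y \in Y -> l \notin S w -> (l \in S y) = (l == e y).
      by move=> yY lT; move/setP/(_ l): (trE y yY); rewrite in_setD lT inE.
    have evT : e v \notin S w.
      by have : e v \in tr v by [rewrite trE // set11]; rewrite in_setD => /andP[].
    have adj_ab : adj a b.
      by apply: Ycover; rewrite // !trE // eab setUid cards1 n3.
    apply: (@edge_cross _ _ maxK p3p2 a b v (e v) k) => //.
    + by rewrite DK // YD.
    + by rewrite inS.
    + by rewrite inS.
    + by rewrite inS // -eab.
    + by rewrite inS.
    + by rewrite inS // -eab.
    + by rewrite inS.
  - move=> a b c d aY bY cY dY.
    by apply: (w4 (v := w)); rewrite adj_sym Yw.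
apply: (col_base (M := Y :\: I) (R := F :|: I)) => //.
- exact: subsetDl.
- apply/subsetP=> x xD; rewrite !in_setU in_setD.
  have [t0|t0] := posnP #|tr x|; first by rewrite tr0.
  have [t1|t1] := ltnP 1 #|tr x|; first by rewrite [x \in F]inE xD t1 ?orbT.
  have -> : x \in Y by rewrite inE xD t0 n3.
  by case: (x \in I); rewrite ?orbT.
- apply: col_sub (col_union cF (col_stable sI)) => //; card_lia.
Qed.

Variable h : nat.
Hypothesis hE : 2 * h <= n <= 2 * h + 1.
Let F := [set y in D | (h < #|tr y|) || (0 < #|tr y|) && (S y :&: T != set0)].
Let Z := [set y in D | (0 < #|tr y| <= h) && (S y :&: T == set0)].

Let ZS y : y \in Z -> S y = tr y.
Proof.
by rewrite inE => /and3P[_ _ /eqP ST]; rewrite /tr setDE -{1}[S y]setIT -(setUCr T) setIUr ST set0U.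
Qed.

(** Types in [F] have more than h vertices and pairwise meet. Two traces of more than h vertices
    cannot be disjoint; a type with a smaller trace contains the nonempty T and misses only two
    vertices of [K :\: T], so it meets every larger trace. *)
Let col_F : 3 < n -> col F (#|K| - h.+1).
Proof.
move=> n4.
have big y : y \in F -> #|tr y| <= h -> [/\ T \subset S y, #|S y| + 2 = #|K|, #|tr y| + 2 = n & 0 < #|T|].
  rewrite inE => /andP[yD /orP[|/andP[y0 yT]] yh]; first card_lia.
  have yY : y \in Y by rewrite inE yD y0 /=; card_lia.
  have [Ty Sy] := Ynested yY yT.
  have Syw : #|S y| = #|T| + #|tr y| by rewrite -(cardsID T (S y)) (setIidPr Ty).
  have T0 : 0 < #|T|.
    rewrite card_gt0; apply: contraNneq yT => T0; apply/eqP; apply/setP=> k.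
    by rewrite in_setI T0 !inE andbF.
  by split=> //; card_lia.
apply: (col_nested maxK p3p2).
- by apply/subsetP=> x; rewrite inE => /andP[].
- move=> x xF; have [xh|xh] := leqP #|tr x| h.
    by have [_ Sx _ T0] := big x xF xh; card_lia.
  by have := subset_leq_card (subsetDl (S x) T); rewrite -/(tr x); card_lia.
have nodisj x y : x \in F -> y \in F -> #|tr x| <= h -> [disjoint S x & S y] -> False.
  move=> xF yF xh dxy; have [Tx _ nx T0] := big x xF xh.
  have := tr_disjoint dxy; have [yh|yh] := leqP #|tr y| h; last by card_lia.
  have [Ty _ _ _] := big y yF yh; move: T0; rewrite card_gt0 => /set0Pn[k kT] _.
  by have := disjointFr dxy (subsetP Tx k kT); rewrite (subsetP Ty).
move=> x y xF yF xy.
have xD : x \in D by move: xF; rewrite inE => /andP[].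
have yD : y \in D by move: yF; rewrite inE => /andP[].
case/or3P: (nested_or_disjoint maxK w4 (DK xD) (DK yD) xy) => [->//|->|dxy]; rewrite ?orbT //.
exfalso; have [xh|xh] := leqP #|tr x| h; first exact: nodisj xh dxy.
have [yh|yh] := leqP #|tr y| h; first by apply: (nodisj y x) => //; rewrite disjoint_sym.
by have := tr_disjoint dxy; card_lia.
Qed.

Let ZY : 3 < n -> Z \subset Y.
Proof.
move=> n4; apply/subsetP=> y; rewrite !inE => /and3P[-> /andP[-> yh] _] /=.
by card_lia.
Qed.

Let D_cover x : x \in D -> [|| x \in B0, x \in Z | x \in F].
Proof.
move=> xD; have [t0|t0] := posnP #|tr x|; first by rewrite tr0.
rewrite [x \in Z]inE [x \in F]inE xD t0 /=; case: leqP => //= _; last by rewrite orbT.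
by case: eqP; rewrite ?orbT.
Qed.

(** Traces below h always satisfy [Ycover], so [M] is a clique. If a type in [H] is repeated, all of
    [Z] is a clique and joins the base; otherwise [H] is a union of two stable sets, affordable
    because h is at least 2. *)
Lemma col_many : 3 < n -> 4 < #|K| -> col [set: G] (2 * #|K|).
Proof.
move=> n4 K5; have /subsetP ZYs := ZY n4.
have nh : 2 <= h by card_lia.
have nK : n <= #|K| by card_lia.
pose M := [set y in Z | #|tr y| < h]; pose H := [set y in Z | #|tr y| == h].
have Zh y : y \in Z -> #|tr y| <= h by rewrite inE => /and3P[_ /andP[]].
have ZD y : y \in Z -> y \in D by rewrite inE => /and3P[].
case: (boolP [exists z, [exists z', [&& z \in H, z' \in Z, z != z' & S z == S z']]]).
  case/existsP=> z /existsP[z' /and4P[zH z'Z zz' /eqP Szz']].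
  move: zH; rewrite inE => /andP[zZ /eqP tz].
  have adj_zz : adj z z'.
    apply: Ycover; rewrite ?ZYs // -!ZS // -Szz' setUid ZS // tz; card_lia.
  (* The edge [z z'] competes in [maxw], so T has at least h vertices and contains an edge of [K]
     missed by all types in [Z]. *)
  have T2 : 1 < #|T|.
    have := maxw (ZD _ zZ) (ZD _ z'Z) adj_zz.
    by rewrite Szz' subxx ZS // -ZS // -Szz' ZS // tz => /(_ isT); card_lia.
  have KU : 1 < #|K :\: (K :\: T)|.
    by rewrite setDDr setDv set0U; move/setIidPr: (nbrs_sub K w) => ->.
  have ZU y : y \in Z -> S y \subset K :\: T by move=> yZ; rewrite ZS.
  have zY y : y \in Z -> y != z -> adj y z.
    move=> yZ yz; have [->|yz'] := eqVneq y z'; first by rewrite adj_sym.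
    apply/negPn/negP=> nyz.
    have nyz' : ~~ adj y z'.
      apply: contra nyz => yz''; apply: (p3_cover maxK p3p2 (y := z') _ _ _ KU); auto.
      by rewrite adj_sym.
    have [|/subsetPn[i iy iz]] := boolP (S y \subset S z).
      move=> Syz; case/negP: nyz; apply: Ycover; rewrite ?ZYs // -!ZS //.
      by rewrite (setUidPr Syz) ZS // tz; card_lia.
    have [j] : exists j, j \in T by apply/set0Pn; rewrite -card_gt0; card_lia.
    move=> jT; have jN v : v \in Z -> j \notin S v.
      by move=> vZ; apply: contraL jT => /(subsetP (ZU v vZ)); rewrite in_setD => /andP[].
    have := @edge_cross _ _ maxK p3p2 z z' y i j adj_zz.
    rewrite DK ?ZD // iy iz -Szz' iz !jN // (subsetP (nbrs_sub K w) j jT) !(adj_sym _ y).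
    by rewrite (negPf nyz) (negPf nyz') => /(_ isT isT isT isT isT isT isT isT).
  have cZ : clique Z.
    apply/cliqueP=> x y xZ yZ xy.
    have [xz|xz] := eqVneq x z; first by rewrite xz adj_sym zY // -xz eq_sym.
    have [->|yz] := eqVneq y z; first exact: zY.
    by apply: (p3_cover maxK p3p2 (y := z) _ _ _ KU); rewrite ?ZU ?zY // adj_sym zY.
  apply: (col_base (M := Z) (R := F)) => //; first exact: ZY.
    by apply/subsetP=> x /D_cover; rewrite !in_setU orbA.
  by apply: col_sub (col_F n4) => //; card_lia.
move=> noH.
have H_neq x y : x \in H -> y \in H -> x != y -> S x != S y.
  move=> xH yH xy; apply: contraNneq noH => Sxy; apply/existsP; exists x; apply/existsP; exists y.
  by rewrite xH xy Sxy eqxx /=; move: yH; rewrite inE => /andP[->].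
have HZ x : x \in H -> x \in Z by rewrite inE => /andP[].
have HS x : x \in H -> #|S x| = h by move=> xH; rewrite ZS ?HZ //; move: xH; rewrite inE => /andP[_ /eqP].
have H_disj x y : x \in H -> y \in H -> adj x y -> [disjoint S x & S y].
  move=> xH yH xy; apply: nested_card => //; rewrite ?DK ?ZD ?HZ ?HS //.
  by apply: H_neq => //; apply: adj_neq.
have [H1 [H2 [HE s1 s2]]] : exists H1, exists H2, [/\ H \subset H1 :|: H2, @stable G H1 & @stable G H2].
  have [H0|[y0 y0H]] := set_0Vmem H.
    by exists set0, set0; rewrite H0 sub0set; split=> // x y; rewrite inE.
  have [i iy0] : exists i, i \in S y0 by apply/set0Pn; rewrite -card_gt0 HS //; card_lia.
  (* Types through [i] meet, so their vertices are nonadjacent. Two adjacent vertices avoiding [i]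
     would force n = 2h + 1 with types covering all of [K :\: T] but [i], while [dy0] makes both
     disjoint from [S y0], which has h vertices. *)
  exists [set x in H | i \in S x], [set x in H | i \notin S x]; split.
  - by apply/subsetP=> x xH; rewrite in_setU 2!inE xH; case: (i \in S x); rewrite ?inE ?xH.
  - move=> x y; rewrite inE => /andP[xH ix]; rewrite inE => /andP[yH iy].
    by apply/negP=> xy; have := disjointFr (H_disj x y xH yH xy) ix; rewrite iy.
  - move=> x y; rewrite inE => /andP[xH ix]; rewrite inE => /andP[yH iy].
    apply/negP=> xy; have dxy := H_disj x y xH yH xy.
    have dy0 v : v \in H -> i \notin S v -> n - 1 <= 2 * h -> #|S v :&: S y0| <= 2 * h - (n - 1).
      move=> vH iv nh2.
      have vy0 : v != y0 by apply: contraNneq iv => ->.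
      have [vy|nvy] := boolP (adj v y0).
        by have := H_disj v y0 vH y0H vy; rewrite -setI_eq0 => /eqP->; rewrite cards0.
      rewrite leqNgt; apply: contra nvy => lt; apply: Ycover; rewrite ?ZYs ?HZ //.
      by rewrite -!ZS ?HZ // cardsU !HS //; card_lia.
    have Ui : i \in K :\: T by apply: (subsetP (tr_sub y0)); rewrite -ZS ?HZ.
    have : #|S x :|: S y :|: S y0| <= n.
      by rewrite -cardU; apply: subset_leq_card; rewrite !subUset (ZS (HZ x xH)) (ZS (HZ y yH)) (ZS (HZ y0 y0H)) !tr_sub.
    have : #|i |: (S x :|: S y)| <= n.
      by rewrite -cardU; apply: subset_leq_card; rewrite !subUset sub1set Ui (ZS (HZ x xH)) (ZS (HZ y yH)) !tr_sub.
    rewrite cardsU1 in_setU negb_or ix iy /=.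
    have := dy0 x xH ix; have := dy0 y yH iy.
    rewrite (cardsU (S x :|: S y)) setIUl.
    have := cardsU (S x :&: S y0) (S y :&: S y0).
    rewrite (cardsU (S x) (S y)); move: dxy; rewrite -setI_eq0 => /eqP->; rewrite cards0 !HS //.
    card_lia.
apply: (col_base (M := M) (R := F :|: (H1 :|: H2))).
- by apply/subsetP=> x; rewrite inE => /andP[/ZYs].
- apply/cliqueP=> x y; rewrite inE => /andP[xZ xh]; rewrite inE => /andP[yZ yh] xy.
  apply: Ycover; rewrite ?ZYs // cardsU; card_lia.
- apply/subsetP=> x /D_cover; rewrite in_setU [x \in _ :|: M]in_setU [x \in F :|: _]in_setU.
  case/or3P=> [->//|xZ|->]; rewrite ?orbT //.
  rewrite [x \in M]inE xZ /=; have := Zh x xZ; rewrite leq_eqVlt => /orP[xh|->]; rewrite ?orbT //.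
  by rewrite (subsetP HE) ?orbT // inE xZ.
- have := col_union (col_F n4) (col_union (col_stable s1) (col_stable s2)).
  by apply: col_sub => //; card_lia.
Qed.

End Base.

(** * The values of the clique number *)

Section Cases.
Variable G : sgraph.
Hypothesis p3p2 : p3p2_free G.
Hypothesis w4 : w4_free G.
Variable K : {set G}.
Hypothesis maxK : max_clique K.
Local Notation S := (nbrs K).
Local Notation D := (deep K).

Let DK y : y \in D -> y \notin K. Proof. by rewrite inE => /andP[]. Qed.

Let card_pair (x y : G) : adj x y -> #|[set x; y]| = 2.
Proof. by move=> /adj_neq xy; rewrite cards2 xy. Qed.

Let clique_pair (x y : G) : adj x y -> clique [set x; y].
Proof.
move=> xy; apply/cliqueP=> u v; rewrite !inE => /orP[]/eqP-> /orP[]/eqP->;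
  by rewrite ?eqxx // adj_sym.
Qed.

Let clique3 (x y z : G) : adj x y -> adj x z -> adj y z -> clique [set x; y; z].
Proof.
move=> xy xz yz; apply: cliqueU; first exact: clique_pair.
  by apply/cliqueP=> u v /set1P-> /set1P->; rewrite eqxx.
by move=> u v; rewrite !inE => /orP[]/eqP-> /eqP->.
Qed.

Let card3 (x y z : G) : adj x y -> adj x z -> adj y z -> #|[set x; y; z]| = 3.
Proof.
move=> xy xz yz; rewrite setUC cardsU1 !inE negb_or card_pair //.
by rewrite eq_sym adj_neq // eq_sym adj_neq.
Qed.

Let p3_free_types X (B : {set G}) : 1 < #|K :\: X| ->
  {in B, forall x, S x \subset X} -> p3_free B.
Proof. by move=> KX BX x y z xB yB zB; apply: (p3_cover maxK p3p2 (X := X)); auto. Qed.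

Let adj_types (x y : G) : x \in D -> y \in D -> adj x y -> #|S x| = #|S y| ->
  S x = S y \/ [disjoint S x & S y].
Proof.
move=> xD yD xy cxy; case/or3P: (nested_or_disjoint maxK w4 (DK xD) (DK yD) xy) => h; last by right.
  by left; apply/eqP; rewrite eqEcard h cxy leqnn.
by left; apply/esym/eqP; rewrite eqEcard h cxy leqnn.
Qed.

(** * Clique number at least five *)

Lemma col_nested_edge (x y : G) : x \in D -> y \in D -> adj x y -> S x \subset S y ->
  #|S y| + 3 <= #|K| -> 4 < #|K| ->
  col [set: G] (2 * #|K|).
Proof.
move=> xD yD xy Sxy top K5.
pose P (p : G * G) := [&& p.1 \in D, p.2 \in D, adj p.1 p.2, S p.1 \subset S p.2
                        & #|S p.2| + 3 <= #|K|].
have Pxy : P (x, y) by rewrite /P /= xD yD xy Sxy.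
case: (@arg_maxnP _ (x, y) P (fun p => #|S p.2|) Pxy) => -[u w]; rewrite {1}/P /= => /and5P[uD wD uw Suw topw] maxw.
have maxw' : {in D &, forall u' w', adj u' w' -> S u' \subset S w' ->
    #|S w'| + 3 <= #|K| -> #|S w'| <= #|S w|}.
  by move=> u' w' u'D w'D u'w' Su'w' topw'; apply: (maxw (u', w')); rewrite /P /= u'D w'D u'w' Su'w'.
have le_yw : #|S y| <= #|S w| by apply: (maxw (x, y)).
have nE : #|K| = #|S w| + (#|K| - #|S w|) by card_lia.
have [n3|n3] := eqVneq (#|K| - #|S w|) 3; first exact: (col_three p3p2 w4 maxK uw Suw topw nE n3).
apply: (col_many p3p2 w4 maxK wD uw Suw topw maxw' nE (h := (#|K| - #|S w|)./2)).
- by move: (#|K| - #|S w|) => n; clear; lia.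
- by card_lia.
- by [].
Qed.

(** Without an edge for [col_nested_edge], adjacent small types are disjoint, so those through [i]
    form a stable set, and likewise for [j]. Types of size |K| - 2 take two colours, four in all;
    the types avoiding [i] and [j] are the base. *)
Lemma col_ge5 : 4 < #|K| -> col [set: G] (2 * #|K|).
Proof.
move=> K5.
case: (boolP [exists x, [exists y, [&& x \in D, y \in D, adj x y, S x \subset S y
                                      & #|S y| + 3 <= #|K|]]]).
  case/existsP=> x /existsP[y /and5P[xD yD xy Sxy top]].
  exact: col_nested_edge xD yD xy Sxy top K5.
move=> none.
have noedge x y : x \in D -> y \in D -> adj x y -> S x \subset S y -> #|S y| + 3 <= #|K| -> False.
  move=> xD yD xy Sxy top; case/negP: none; apply/existsP; exists x; apply/existsP; exists y.
  by rewrite xD yD xy Sxy.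
have /card_gt1P[i [j [iK jK ij]]] : 1 < #|K| by card_lia.
pose F0 := [set x in D | #|K| <= #|S x| + 2].
pose A k := [set x in D | (#|S x| + 3 <= #|K|) && (k \in S x)].
have sA k : stable (A k).
  move=> x y; rewrite inE => /and3P[xD xt kx]; rewrite inE => /and3P[yD yt ky].
  apply/negP=> xy; case/or3P: (nested_or_disjoint maxK w4 (DK xD) (DK yD) xy) => h.
  - exact: noedge xy h yt.
  - by apply: (noedge y x) => //; rewrite adj_sym.
  - by rewrite (disjointFr h kx) in ky.
have cF : col F0 (#|K| - (#|K| - 2)).
  apply: (col_nested maxK p3p2).
  - by apply/subsetP=> x; rewrite inE => /andP[].
  - by move=> x; rewrite inE => /andP[_]; card_lia.
  - move=> x y; rewrite inE => /andP[xD xt]; rewrite inE => /andP[yD yt] xy.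
    case/or3P: (nested_or_disjoint maxK w4 (DK xD) (DK yD) xy) => [->//|->|h]; rewrite ?orbT //.
    have : #|S x :|: S y| <= #|K| by apply: subset_leq_card; rewrite subUset !nbrs_sub.
    by rewrite cardsU; move: h; rewrite -setI_eq0 => /eqP->; rewrite cards0; card_lia.
pose B := [set x in D | S x \subset K :\: [set i; j]].
apply: (@col_budget G w4 K maxK B (F0 :|: (A i :|: A j))); first card_lia.
- by apply/subsetP=> x; rewrite inE => /andP[].
- apply: (@p3_free_types (K :\: [set i; j])); last by move=> x; rewrite inE => /andP[].
  rewrite setDDr setDv set0U; suff /setIidPr-> : [set i; j] \subset K by rewrite cards2 ij.
  by apply/subsetP=> k; rewrite !inE => /orP[]/eqP->.
- apply/subsetP=> x xD; rewrite !in_setU [x \in B]inE [x \in F0]inE [x \in A i]inE [x \in A j]inE xD /=.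
  have [_|lt] := leqP #|K| (#|S x| + 2); first by rewrite orbT.
  have -> : #|S x| + 3 <= #|K| by card_lia.
  case ix: (i \in S x); rewrite ?orbT //; case jx: (j \in S x); rewrite ?orbT //= orbF.
  apply/subsetP=> k kx; rewrite in_setD (subsetP (nbrs_sub K x) k kx) andbT.
  rewrite !inE negb_or; apply/andP; split; [move: ix | move: jx]; by apply: contraFneq => <-.
- by apply: col_sub (col_union cF (col_union (col_stable (sA i)) (col_stable (sA j)))) => //; card_lia.
Qed.

(** * Clique number four *)

Section Four.
Hypothesis K4 : #|K| = 4.

Let D2 y : y \in D -> #|S y| <= 2. Proof. by rewrite inE K4 => /andP[_]; card_lia. Qed.

Hypothesis notop1 : forall x y, x \in D -> y \in D -> adj x y -> S x \subset S y -> #|S y| != 1.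

(** Each nonempty deep type has size 2 and its vertex is adjacent to [u] and [v]. The neighbours of
    [x] in [H] have type [S x] or its complement, each at most once since a repetition would give a
    5-clique; so degrees in [H] are at most 2. *)
Let col_empty_edge (u v : G) : u \in D -> v \in D -> adj u v -> S u = set0 -> S v = set0 ->
  col [set: G] 8.
Proof.
move=> uD vD uv Su Sv.
have card_D2 y : y \in D -> S y != set0 -> [/\ #|S y| = 2, adj y u & adj y v].
  move=> yD y0; have [i iy] := set0Pn _ y0.
  have [j] : exists j, j \in K :\: S y.
    apply/set0Pn; rewrite -card_gt0 cardsD; move/setIidPr: (nbrs_sub K y) => ->.
    by have := D2 yD; card_lia.
  rewrite in_setD => /andP[jy jK].
  have y1 e : e \in D -> S e = set0 -> adj e y -> #|S y| != 1.
    by move=> eD Se ey; apply: (notop1 eD yD ey); rewrite Se sub0set.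
  have cover x : S x = set0 -> S x \subset S y by move=> ->; apply: sub0set.
  have Ky : 1 < #|K :\: S y|.
    by rewrite cardsD; move/setIidPr: (nbrs_sub K y) => ->; have := D2 yD; card_lia.
  have yu : y != u by apply: contraNneq y0 => ->; rewrite Su.
  have yv : y != v by apply: contraNneq y0 => ->; rewrite Sv.
  have := @edge_cross _ _ maxK p3p2 u v y i j uv (DK yD) iy.
  rewrite Su Sv !in_set0 => /(_ isT isT jK isT isT jy) uvy.
  have [yu' yv'] : adj y u /\ adj y v.
    case/orP: uvy; rewrite adj_sym => h; split=> //.
    - by apply: (p3_cover maxK p3p2 (y := u) _ _ _ Ky) => //; auto.
    - by apply: (p3_cover maxK p3p2 (y := v) _ _ _ Ky) => //; auto; rewrite adj_sym.
  split=> //; have := D2 yD; have := y1 u uD Su; rewrite adj_sym => /(_ yu').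
  by move: y0; rewrite -card_gt0; card_lia.
pose B := [set x in D | S x == set0]; pose H := [set x in D | S x != set0].
have cH : col H 3.
  apply: col_degenerate => C /subsetP CH /set0Pn[x xC]; exists x => //; rewrite ltnS.
  set N := [set y in C | adj x y].
  have Hx y : y \in C -> [/\ y \in D, #|S y| = 2, adj y u & adj y v].
    by move=> /CH; rewrite inE => /andP[yD /(card_D2 y yD)[]].
  have [xD Sx xu xv] := Hx x xC.
  have injS : {in N &, injective S}.
    move=> y z; rewrite inE => /andP[yC xy]; rewrite inE => /andP[zC xz] Syz.
    apply/eqP/negPn/negP=> yz.
    have [yD Sy yu yv] := Hx y yC; have [zD Sz zu zv] := Hx z zC.
    have Ky : 1 < #|K :\: S y|.
      by rewrite cardsD; move/setIidPr: (nbrs_sub K y) => ->; card_lia.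
    have adj_yz : adj y z.
      apply: (p3_cover maxK p3p2 (y := u) _ _ _ Ky) => //; rewrite ?Su ?sub0set -?Syz //.
      by rewrite adj_sym.
    case: maxK => _ mK.
    have := mK ([set x; y; z] :|: [set u; v]).
    have -> : #|[set x; y; z] :|: [set u; v]| = 5.
      rewrite cardsU card3 // card_pair //.
      suff -> : [set x; y; z] :&: [set u; v] = set0 by rewrite cards0.
      apply/eqP; rewrite setI_eq0 disjoint_subset; apply/subsetP=> t.
      have ne s e : #|S s| = 2 -> S e = set0 -> (s == e) = false.
        by move=> s2 Se; apply: contra_eqF s2 => /eqP->; rewrite Se cards0.
      by rewrite !inE -orbA => /or3P[]/eqP->; rewrite !ne.
    rewrite K4 => h; suff : 5 <= 4 by [].
    apply: h; apply: cliqueU; [exact: clique3 | exact: clique_pair |].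
    by move=> s t; rewrite !inE -orbA => /or3P[]/eqP-> /orP[]/eqP->.
  have : S @: N \subset [set S x; K :\: S x].
    apply/subsetP=> X /imsetP[y]; rewrite inE => /andP[yC xy] ->.
    have [yD Sy _ _] := Hx y yC; rewrite !inE.
    have := adj_types xD yD xy; rewrite Sx Sy => /(_ erefl)[->|dxy]; first by rewrite eqxx.
    apply/orP; right; rewrite eqEcard cardsD; move/setIidPr: (nbrs_sub K x) => ->.
    rewrite Sx Sy K4 andbT; apply/subsetP=> k ky.
    by rewrite in_setD (subsetP (nbrs_sub K y)) // (disjointFl dxy ky).
  move/subset_leq_card; rewrite card_in_imset // cards2; card_lia.
have -> : 8 = 2 * #|K| by rewrite K4.
apply: (@col_budget G w4 K maxK B H); rewrite ?K4 //.
- by apply/subsetP=> x; rewrite inE => /andP[].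
- apply: (@p3_free_types set0); first by rewrite setD0 K4.
  by move=> x; rewrite inE => /andP[_ /eqP->].
- by apply/subsetP=> x xD; rewrite in_setU [x \in B]inE [x \in H]inE xD; case: eqP.
Qed.

(** The edge [u v] forces every deep type into T or into its complement. The complement gives the
    base, and the nonempty types inside T need three colours. *)
Let col_double (u v : G) : u \in D -> v \in D -> adj u v -> S u = S v -> #|S u| = 2 ->
  col [set: G] 8.
Proof.
move=> uD vD uv Suv Su2; set T := S u.
have T2 : #|K :\: (K :\: T)| = 2.
  by rewrite setDDr setDv set0U; move/setIidPr: (nbrs_sub K u) => ->.
have cardKT : #|K :\: T| = 2.
  by rewrite cardsD; move/setIidPr: (nbrs_sub K u) => ->; rewrite K4 Su2.
have types x : x \in D -> (S x \subset T) || (S x \subset K :\: T).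
  move=> xD; apply/negPn/negP; rewrite negb_or => /andP[/subsetPn[i ix iT] /subsetPn[k kx]].
  have kK := subsetP (nbrs_sub K x) k kx.
  rewrite in_setD kK andbT negbK => kT.
  have ik : i != k by apply: contraNneq iT => ->.
  have ikx : [set i; k] = S x.
    apply/eqP; rewrite eqEcard cards2 ik D2 // andbT.
    by apply/subsetP=> l; rewrite !inE => /orP[]/eqP->; rewrite -in_nbrs.
  have [j] : exists j, j \in (K :\: T) :\ i.
    apply/set0Pn; rewrite -card_gt0; have := cardsD1 i (K :\: T).
    by rewrite cardKT; case: (i \in _) => /=; card_lia.
  rewrite in_setD1 in_setD => /and3P[ji jT jK].
  have jx : j \notin S x.
    by rewrite -ikx in_set2 (negPf ji) /=; apply: contraNneq jT => ->.
  have := @edge_cross _ _ maxK p3p2 u v x i j uv (DK xD) ix iT.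
  rewrite -Suv => /(_ iT jK jT jT jx).
  suff nadj e : e \in D -> S e = T -> adj e x -> False by case/orP => [/nadj|/nadj]; apply.
  move=> eD eT ex; have := adj_types eD xD ex; rewrite eT Su2.
  rewrite -ikx cards2 ik => /(_ erefl)[TE|dT].
    by case/negP: iT; rewrite TE !inE eqxx.
  by have := disjointFr dT kT; rewrite !inE eqxx orbT.
pose B := [set x in D | S x \subset K :\: T].
pose C := [set x in D | (S x \subset T) && (S x != set0)].
have pC : p3_free C.
  by apply: (@p3_free_types T); rewrite ?cardKT // => x; rewrite inE => /and3P[].
have cC : col C 3.
  apply: col_degenerate => E /subsetP EC /set0Pn[x xE]; exists x => //; rewrite ltnNge; apply/negP.
  set N := [set y in E | adj x y] => N3.
  have QE y : y \in x |: N -> y \in C.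
    by rewrite in_setU1 => /predU1P[->|]; [apply: EC | rewrite inE => /andP[/EC]].
  have cQ : clique (x |: N).
    apply/cliqueP=> y z; rewrite !in_setU1 => /predU1P[->|yN] /predU1P[->|zN] yz.
    - by rewrite eqxx in yz.
    - by move: zN; rewrite inE => /andP[].
    - by move: yN; rewrite inE adj_sym => /andP[].
    - apply: (pC y x z) => //; try by apply: QE; rewrite in_setU1 ?eqxx ?yN ?zN ?orbT.
        by move: yN; rewrite inE adj_sym => /andP[].
      by move: zN; rewrite inE => /andP[].
  have Q4 : 3 < #|x |: N|.
    by rewrite cardsU1; have -> : x \notin N by rewrite inE adj_irrefl andbF.
  have CD y : y \in C -> y \in D by rewrite inE => /andP[].
  have dQK : [disjoint x |: N & K].
    by rewrite disjoint_subset; apply/subsetP=> y /QE /CD /DK; rewrite inE.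
  (* If all members of the 4-clique were adjacent to [p], there would be a 5-clique. Hence some [a]
     and [b] have the two singleton types, a third member [c] has type T by [notop1], and [c] is the
     hub of a W4 with rim [p], [a], [b], [q]. *)
  have avoid p : p \in T -> exists2 b, b \in x |: N & p \notin S b.
    move=> pT; have [|/subsetPn[b bQ]] := boolP (x |: N \subset [set y | p \in S y]).
      move/subsetP=> allp; have := clique_common maxK cQ dQK (X := [set p]).
      rewrite cards1 K4 => h; suff : #|x |: N| + 1 <= 4 by card_lia.
      apply: h; last by rewrite sub1set (subsetP (nbrs_sub K u)).
      by move=> y /allp; rewrite inE sub1set.
    by rewrite inE => bp; exists b.
  have /cards2P[p [q [pq TE]]] : #|S u| == 2 by rewrite Su2.
  have pT : p \in T by rewrite /T TE !inE eqxx.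
  have qT : q \in T by rewrite /T TE !inE eqxx orbT.
  have [b bQ pb] := avoid p pT; have [a aQ qa] := avoid q qT.
  have single y r s : y \in C -> T = [set r; s] -> s \notin S y -> S y = [set r].
    rewrite inE => /and3P[yD yT y0] Trs sy.
    have : S y \subset [set r].
      apply/subsetP=> l ly; have := subsetP yT l ly; rewrite Trs !in_set1 in_setU !in_set1.
      by case/orP=> [//|/eqP ls]; rewrite -ls ly in sy.
    by rewrite subset1 (negPf y0) orbF => /eqP.
  have TE' : T = [set q; p] by rewrite /T TE setUC.
  have Sb := single b q p (QE b bQ) TE' pb; have Sa := single a p q (QE a aQ) TE qa.
  have adjQ y z : y \in x |: N -> z \in x |: N -> y != z -> adj y z by move/cliqueP: cQ; apply.
  have solo y z r : y \in x |: N -> z \in x |: N -> S y = [set r] -> S z = [set r] -> y = z.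
    move=> yQ zQ Sy Sz; apply/eqP/negPn/negP=> yz.
    have := notop1 (CD _ (QE _ yQ)) (CD _ (QE _ zQ)) (adjQ _ _ yQ zQ yz).
    by rewrite Sy Sz subxx cards1 => /(_ isT).
  have [c] : exists c, c \in (x |: N) :\: [set a; b].
    apply/set0Pn; rewrite -card_gt0 cardsD.
    have := subset_leq_card (subsetIr (x |: N) [set a; b]).
    by rewrite cards2; case: (a != b); card_lia.
  rewrite in_setD in_set2 negb_or => /andP[/andP[ca cb] cQ'].
  have qc : q \in S c.
    by apply: contraNT ca => qc; apply/eqP; apply: (solo c a p) => //; apply: single (QE c cQ') TE qc.
  have pc : p \in S c.
    by apply: contraNT cb => pc; apply/eqP; apply: (solo c b q) => //; apply: single (QE c cQ') TE' pc.
  have ab : a != b by apply: contraNneq pb => <-; rewrite Sa set11.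
  have pa : p \in S a by rewrite Sa set11.
  have qb : q \in S b by rewrite Sb set11.
  move: pa qb pc qc pb qa; rewrite !inE => /andP[pK pa] /andP[qK qb] /andP[_ pc] /andP[_ qc].
  rewrite pK qK /= => npb nqa.
  have := w4 (v := c) (a := p) (b := a) (c := b) (d := q).
  rewrite (adj_sym c p) (adj_sym c q) pc qc pa (adj_sym b q) qb (negPf npb) (adj_sym a q) (negPf nqa).
  rewrite (adjQ c a) // (adjQ c b) // (adjQ a b) // => /(_ isT isT isT isT isT isT isT).
  have qp : adj q p by case: maxK => /cliqueP cK _; apply: cK => //; rewrite eq_sym.
  have pNb : p != b by apply: contraTneq bQ => <-; rewrite (disjointFl dQK).
  have aNq : a != q by apply: contraTneq aQ => ->; rewrite (disjointFl dQK).
  by move/(_ qp pNb aNq).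
have -> : 8 = 2 * #|K| by rewrite K4.
apply: (@col_budget G w4 K maxK B C); rewrite ?K4 //.
- by apply/subsetP=> x; rewrite inE => /andP[].
- by apply: (@p3_free_types (K :\: T)); rewrite ?T2 // => x; rewrite inE => /andP[].
- apply/subsetP=> x xD; rewrite in_setU [x \in B]inE [x \in C]inE xD /=.
  have /orP[->|->] := types x xD; last by [].
  by have [->|] := eqVneq (S x) set0; rewrite ?sub0set ?orbT.
Qed.

(** Each type class is stable. The 2-types avoiding [a] lie in three vertices and so pairwise meet,
    and those through [a] meet too, so all 2-types need two colours. The vertices of [K] reuse the
    colours of classes they are not adjacent to. *)
Let col_simple : {in D &, forall x y, adj x y -> S x != S y} -> col [set: G] 8.
Proof.
move=> simple.
have stable_type (A : {set G}) : A \subset D -> {in A &, forall x y, S x = S y} -> stable A.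
  move=> /subsetP AD AS x y xA yA; apply/negP=> xy.
  by have := simple x y (AD _ xA) (AD _ yA) xy; rewrite (AS x y) ?eqxx.
have stable_add k (A : {set G}) : stable A -> {in A, forall x, ~~ adj k x} -> stable (k |: A).
  move=> sA kA x y; rewrite !in_setU1 => /predU1P[->|xA] /predU1P[->|yA].
  - by rewrite adj_irrefl.
  - exact: kA.
  - by rewrite adj_sym kA.
  - exact: sA.
pose T X := [set x in D | S x == X].
have sT X : stable (T X).
  apply: stable_type; first by apply/subsetP=> x; rewrite inE => /andP[].
  by move=> x y; rewrite !inE => /andP[_ /eqP->] /andP[_ /eqP->].
have [a [b [c [d [KE aK]]]]] : exists a b c d, K =i [:: a; b; c; d] /\ a \in K.
  have := mem_enum K; have : size (enum K) = 4 by rewrite -cardE.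
  case: (enum K) => [|a [|b [|c [|d []]]]] // _ KE.
  by exists a, b, c, d; split=> [x|]; rewrite -KE // !inE eqxx.
pose P := [set x in D | (#|S x| == 2) && (a \notin S x)].
pose P' := [set x in D | (#|S x| == 2) && (a \in S x)].
have sP : stable P.
  move=> x y; rewrite inE => /and3P[xD /eqP x2 ax]; rewrite inE => /and3P[yD /eqP y2 ay].
  apply/negP=> xy; have := adj_types xD yD xy; rewrite x2 y2 => /(_ erefl)[e|dxy].
    by have := simple x y xD yD xy; rewrite e eqxx.
  have : #|a |: (S x :|: S y)| <= 4.
    by rewrite -K4; apply: subset_leq_card; rewrite !subUset sub1set aK !nbrs_sub.
  rewrite cardsU1 in_setU negb_or ax ay cardsU x2 y2.
  by move: dxy; rewrite -setI_eq0 => /eqP->; rewrite cards0.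
have sP' : stable P'.
  move=> x y; rewrite inE => /and3P[xD /eqP x2 ax]; rewrite inE => /and3P[yD /eqP y2 ay].
  apply/negP=> xy; have := adj_types xD yD xy; rewrite x2 y2 => /(_ erefl)[e|dxy].
    by have := simple x y xD yD xy; rewrite e eqxx.
  by have := disjointFr dxy ax; rewrite ay.
have nadj k (A : {set G}) : k \in K -> {in A, forall x, k \notin S x} -> {in A, forall x, ~~ adj k x}.
  by move=> kK kA x /kA; rewrite inE kK.
have TN k l : k != l -> {in T [set l], forall x, k \notin S x}.
  by move=> kl x; rewrite inE => /andP[_ /eqP->]; rewrite inE.
have inK k : k \in [:: a; b; c; d] -> k \in K by rewrite KE.
have uK : uniq [:: a; b; c; d].
  apply/card_uniqP; rewrite /= -K4; apply: eq_card => x; exact/esym/KE.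
move: uK; rewrite /= !inE !negb_or -!andbA => /and5P[ab _ _ bc /and3P[_ cd _]].
have c1 : col (a |: P) 1.
  apply: col_stable; apply: stable_add => //; apply: nadj => // x.
  by rewrite inE => /and3P[].
have cT k l : k \in K -> k != l -> col (k |: T [set l]) 1.
  by move=> kK kl; apply: col_stable; apply: stable_add (sT _) _; apply: nadj => //; apply: TN.
have c2 : col (b |: T [set a]) 1 by apply: cT; rewrite ?inK ?inE ?eqxx ?orbT // eq_sym.
have c3 : col (c |: T [set b]) 1 by apply: cT; rewrite ?inK ?inE ?eqxx ?orbT // eq_sym.
have c4 : col (d |: T [set c]) 1 by apply: cT; rewrite ?inK ?inE ?eqxx ?orbT // eq_sym.
have cI : col (almost K) 1 by apply: col_stable; apply: almost_stable => //; rewrite K4.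
have call := col_union (col_union (col_union c1 c2) (col_union c3 c4))
  (col_union (col_union (col_stable (sT [set d])) (col_stable (sT set0)))
             (col_union (col_stable sP') cI)).
apply: col_sub call; last by [].
apply/subsetP=> x _; have := in_setT x; rewrite -(vertex_cover maxK) !in_setU !in_set1 KE !in_cons in_nil.
case/orP=> [/orP[|->]|xD]; rewrite ?orbT //.
  by case/or4P=> [/eqP->|/eqP->|/eqP->|]; rewrite ?orbF ?eqxx ?orbT // => ->; rewrite ?orbT.
have TE X : (x \in T X) = (S x == X) by rewrite inE xD.
rewrite !TE [x \in P]inE [x \in P']inE xD /=.
have [x0|x0] := eqVneq (S x) set0; rewrite ?orbT //.
have [x2|x2] := eqVneq #|S x| 2; first by case: (a \in S x); rewrite ?orbT.
have : #|S x| == 1 by have := D2 xD; move: x0; rewrite -card_gt0; card_lia.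
case/cards1P=> k Sx; have : k \in K by apply: (subsetP (nbrs_sub K x)); rewrite Sx set11.
rewrite KE !inE Sx => /or4P[]/eqP->; rewrite eqxx ?orbT //.
Qed.

Lemma col_4_simple : col [set: G] 8.
Proof.
case: (boolP [exists u, [exists v, [&& u \in D, v \in D, adj u v & S u == S v]]]); last first.
  move=> none; apply: col_simple => x y xD yD xy; apply: contra none => Sxy.
  by apply/existsP; exists x; apply/existsP; exists y; rewrite xD yD xy.
case/existsP=> u /existsP[v /and4P[uD vD uv /eqP Suv]].
have := notop1 uD vD uv; rewrite {1}Suv subxx -Suv => /(_ isT) Su1.
have [Su2|Su2] := eqVneq #|S u| 2; first exact: (col_double uD vD uv).
have Su0 : S u = set0 by apply/eqP; rewrite -cards_eq0; have := D2 uD; card_lia.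
by apply: (col_empty_edge uD vD uv); rewrite -?Suv.
Qed.

End Four.

Lemma col_4 : #|K| = 4 -> col [set: G] (2 * #|K|).
Proof.
move=> K4; case: (boolP [exists x, [exists y, [&& x \in D, y \in D, adj x y,
    S x \subset S y & #|S y| == 1]]]).
  case/existsP=> x /existsP[y /and5P[xD yD xy Sxy /eqP Sy1]].
  by apply: (@col_three G p3p2 w4 K maxK x y xy Sxy _ 3); rewrite ?Sy1 ?K4.
move=> none; rewrite K4; apply: (col_4_simple K4) => x y xD yD xy Sxy.
apply: contra none => Sy1; apply/existsP; exists x; apply/existsP; exists y.
by rewrite xD yD xy Sxy.
Qed.

(** * Clique number at most two *)

Lemma col_2 : #|K| = 2 -> col [set: G] (2 * #|K|).
Proof.
move=> K2; pose B := [set x in D | S x == set0]; pose A k := [set x | (x \notin K) && (k \in S x)].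
have sA k : k \in K -> stable (A k).
  move=> kK x y; rewrite inE => /andP[xK kx]; rewrite inE => /andP[yK ky].
  apply/negP=> xy; have := clique_common maxK (clique_pair xy) (X := [set k]).
  rewrite cards1 K2 card_pair // => h; suff : 2 + 1 <= 2 by [].
  apply: h; last by rewrite sub1set.
    by rewrite disjoint_subset; apply/subsetP=> z; rewrite !inE => /orP[]/eqP->.
  by move=> z; rewrite !inE sub1set => /orP[]/eqP->.
have dBK : [disjoint B & K].
  by rewrite disjoint_subset; apply/subsetP=> x; rewrite inE => /andP[/DK]; rewrite inE.
have cB : col (K :|: B) #|K|.
  apply: (col_p3_free maxK dBK); apply: (@p3_free_types set0); first by rewrite setD0 K2.
  by move=> x; rewrite inE => /andP[_ /eqP->].
have /cards2P[a [b [_ KE]]] : #|K| == 2 by rewrite K2.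
have aK : a \in K by rewrite KE !inE eqxx.
have bK : b \in K by rewrite KE !inE eqxx orbT.
have := col_union cB (col_union (col_stable (sA a aK)) (col_stable (sA b bK))).
apply: col_sub; last by rewrite K2.
apply/subsetP=> x _; rewrite !in_setU [x \in B]inE [x \in A a]inE [x \in A b]inE.
case xK: (x \in K) => //=; have [x0|x0] := eqVneq (S x) set0.
  by rewrite inE xK x0 cards0 K2.
have [k kx] := set0Pn _ x0; have := subsetP (nbrs_sub K x) k kx.
by rewrite {1}KE !in_set2 => /orP[]/eqP ek; rewrite -ek kx ?orbT.
Qed.

Lemma col_1 : #|K| <= 1 -> col [set: G] (2 * #|K|).
Proof.
case: maxK => _ mK K1; have noadj (x y : G) : ~~ adj x y.
  by apply/negP=> xy; have := mK _ (clique_pair xy); rewrite card_pair // leqNgt ltnS K1.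
have sT : stable [set: G] by move=> x y _ _; apply: noadj.
have [K0|K0] := posnP #|K|; last first.
  by apply: col_sub (col_stable sT) => //; card_lia.
exists (fun=> 0) => [x _|x y _ _ xy]; last by rewrite (negPf (noadj x y)) in xy.
(* Here no colour is available, but an empty maximum clique leaves no vertex to colour. *)
have c1 : clique [set x] by apply/cliqueP=> y z /set1P-> /set1P->; rewrite eqxx.
by have := mK _ c1; rewrite cards1 K0.
Qed.

(** * Clique number three *)

Section Three.
Hypothesis K3 : #|K| = 3.

Let below i := [set x in D | S x \subset [set i]].

Let D1 x : x \in D -> #|S x| <= 1. Proof. by rewrite inE K3 => /andP[_]; lia. Qed.

Let p3_below i : i \in K -> p3_free (below i).
Proof.
move=> iK; apply: (@p3_free_types [set i]); last by move=> x; rewrite inE => /andP[].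
by have := cardsD1 i K; rewrite iK K3 -/(K :\ i); card_lia.
Qed.

(* The vertices with exactly one neighbour in [K :\ i] miss exactly one vertex
   of the triangle [p q r], so they are stable for the same reason as [almost]. *)
Let col_triangle i p q r : i \in K -> p \in below i -> q \in below i -> r \in below i ->
  adj p q -> adj p r -> adj q r -> col [set: G] 6.
Proof.
move=> iK pB qB rB pq pr qr; pose Q := [set p; q; r].
have cQ : clique Q by apply: clique3.
have Q3 : #|Q| = 3 by apply: card3.
have maxQ : max_clique Q by split=> // A cA; case: maxK => _ mK; rewrite Q3 -K3; apply: mK.
have QB x : x \in Q -> x \in below i by rewrite !(in_setU, in_set1) -orbA => /or3P[]/eqP->.
have Qi x k : x \in Q -> k != i -> k \notin S x.
  move=> /QB; rewrite inE => /andP[_ /subsetP xi] ki; apply: contra ki => /xi.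
  by rewrite in_set1.
pose Y := [set x | (x \notin K) && (#|S x :\ i| == 1)].
have Ysub : Y \subset almost Q.
  apply/subsetP=> x; rewrite inE => /andP[xK /cards1P[j Sj]].
  have : j \in S x :\ i by rewrite Sj set11.
  rewrite in_setD1 => /andP[ji jx].
  have xQ : x \notin Q by apply: contraL jx => xQ; apply: Qi.
  rewrite inE xQ Q3 /= eqn_leq; apply/andP; split.
    by have := nbrs_proper maxQ xQ; rewrite Q3.
  have [j'] : exists j', j' \in (K :\ i) :\ j.
    apply/set0Pn; rewrite -card_gt0; have := cardsD1 i K; have := cardsD1 j (K :\ i).
    by rewrite iK K3; case: (_ \in _) => /=; card_lia.
  rewrite !in_setD1 => /and3P[j'j j'i j'K].
  have j'x : j' \notin S x.
    apply: contra j'j => j'x; have : j' \in S x :\ i by rewrite in_setD1 j'i.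
    by rewrite Sj in_set1.
  (* If [x] missed two vertices [s], [t] of [Q], the path [x], [j], [j'] and the edge [s t] would be
     an induced P3 u P2. *)
  rewrite leqNgt; apply/negP=> lt.
  have /card_gt1P[s [t [sQ tQ st]]] : 1 < #|Q :\: nbrs Q x|.
    by rewrite cardsD; move/setIidPr: (nbrs_sub Q x) => ->; rewrite Q3; card_lia.
  move: sQ tQ; rewrite !in_setD !in_nbrs => /andP[sx sQ] /andP[tx tQ].
  rewrite sQ /= in sx; rewrite tQ /= in tx.
  have adj_st : adj s t by move/cliqueP: cQ; apply.
  have := @edge_cross _ _ maxK p3p2 s t x j j' adj_st xK jx (Qi s j sQ ji) (Qi t j tQ ji)
    j'K (Qi s j' sQ j'i) (Qi t j' tQ j'i) j'x.
  by rewrite (negPf sx) (negPf tx).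
have sY : stable Y.
  move=> x y xY yY; apply: (almost_stable maxQ w4); rewrite ?Q3 //; exact: (subsetP Ysub).
have dBK : [disjoint below i & K].
  by rewrite disjoint_subset; apply/subsetP=> x; rewrite inE => /andP[/DK]; rewrite inE.
have K2 : 2 < #|K| by rewrite K3.
have := col_union (col_p3_free maxK dBK (p3_below iK))
  (col_union (col_stable sY) (col_stable (almost_stable maxK w4 K2))).
apply: col_sub; last by rewrite K3.
apply/subsetP=> x _; have := in_setT x; rewrite -(vertex_cover maxK) !in_setU.
case/orP=> [/orP[->|->]|xD]; rewrite ?orbT //.
rewrite [x \in Y]inE (DK xD) /=.
have := subset_leq_card (subsetDl (S x) [set i]); have := D1 xD.
have [i0|i0] := posnP #|S x :\ i| => x1 ix.
  suff -> : x \in below i by rewrite ?orbT.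
  by rewrite inE xD -setD_eq0 -cards_eq0 i0.
have -> : #|S x :\ i| == 1 by card_lia.
by rewrite ?orbT.
Qed.

(** A P3-free set without triangles has maximum degree 1, and [k] has no neighbour in [below i]. *)
Let col_below k i : i \in K -> k \in K -> k != i ->
  (forall p q r, p \in below i -> q \in below i -> r \in below i ->
     adj p q -> adj p r -> adj q r -> False) ->
  col (k |: below i) 2.
Proof.
move=> iK kK ki notri; apply: col_degenerate => A /subsetP AB /set0Pn[x xA].
exists x => //; rewrite ltnNge; apply/negP=> /card_gt1P[y [z [yN zN yz]]].
move: yN zN; rewrite !in_set => /andP[yA xy] /andP[zA xz].
have kB y' : y' \in below i -> adj k y' = false.
  rewrite inE => /andP[_ /subsetP yi]; apply: contraNF ki => ky.
  by have := yi k; rewrite !inE kK ky => /(_ isT).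
have inB v v' : v \in A -> v' \in A -> adj v v' -> v \in below i.
  move=> /AB; rewrite in_setU1 => /predU1P[->|//] /AB; rewrite in_setU1 => /predU1P[->|/kB->//].
  by rewrite adj_irrefl.
have xB := inB _ _ xA yA xy; rewrite adj_sym in xy; have yB := inB _ _ yA xA xy.
have zx := xz; rewrite adj_sym in zx; have zB := inB _ _ zA xA zx.
apply: (notri x y z) => //; first by rewrite adj_sym.
exact: (p3_below iK yB xB zB).
Qed.

(** If no vertex is almost complete to [K], three sets [k |: below i] suffice. Otherwise an almost
    vertex [x] of type [[set a; b]] gives a second triangle [Q], whose almost set absorbs [c] and
    the deep vertices of type [[set a]] or [[set b]] adjacent to [x]. *)
Let col_no_triangle :
  (forall i p q r, i \in K -> p \in below i -> q \in below i -> r \in below i ->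
     adj p q -> adj p r -> adj q r -> False) ->
  col [set: G] 6.
Proof.
move=> notri.
have cB k i : i \in K -> k \in K -> k != i -> col (k |: below i) 2.
  by move=> iK kK ki; apply: col_below => // p q r; apply: notri.
have inB x i : x \in D -> S x \subset [set i] -> x \in below i by move=> xD Sx; rewrite inE xD.
have types x : x \in D -> S x = set0 \/ exists2 k, k \in K & S x = [set k].
  move=> xD; have [x0|x0] := eqVneq (S x) set0; [by left | right].
  have /cards1P[k Sk] : #|S x| == 1 by have := D1 xD; move: x0; rewrite -card_gt0; card_lia.
  by exists k => //; apply: (subsetP (nbrs_sub K x)); rewrite Sk set11.
have [I0|[x xI]] := set_0Vmem (almost K).
  have [a [b [c [KE uK]]]] : exists a b c, K =i [:: a; b; c] /\ uniq [:: a; b; c].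
    have := enum_uniq (mem K); have := mem_enum K; have : size (enum K) = 3 by rewrite -cardE.
    case: (enum K) => [|a [|b [|c []]]] // _ KE uK.
    by exists a, b, c; split=> // x; rewrite -KE.
  move: uK; rewrite /= !inE !negb_or => /and3P[/andP[ab ac] bc _].
  have inK k : k \in [:: a; b; c] -> k \in K by rewrite KE.
  have [aK bK cK] : [/\ a \in K, b \in K & c \in K] by rewrite !inK ?inE ?eqxx ?orbT.
  rewrite eq_sym in ab; rewrite eq_sym in bc.
  have := col_union (cB b a aK bK ab) (col_union (cB c b bK cK bc) (cB a c cK aK ac)).
  apply: col_sub => //; apply/subsetP=> x _; have := in_setT x.
  rewrite -(vertex_cover maxK) I0 setU0 !in_setU !in_set1 KE !in_cons in_nil orbF.
  case/orP=> [/or3P[]->|xD]; rewrite ?orbT //.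
  case: (types x xD) => [Sx|[k + Sx]]; first by rewrite (inB x a) ?orbT // Sx sub0set.
  by rewrite KE !in_cons in_nil orbF => /or3P[]/eqP kE; rewrite -kE (inB x k) ?Sx // ?orbT.
have [xK Sx2] : x \notin K /\ #|S x| = 2 by move: xI; rewrite inE K3 => /andP[-> /eqP].
have /cards2P[a [b [ab SE]]] : #|S x| == 2 by rewrite Sx2.
have [aS bS] : a \in S x /\ b \in S x by rewrite SE !inE !eqxx orbT.
have [aK ax] : a \in K /\ adj a x by move: aS; rewrite inE => /andP[].
have [bK bx] : b \in K /\ adj b x by move: bS; rewrite inE => /andP[].
have /cards1P[c Kc] : #|K :\: S x| == 1.
  by rewrite cardsD; move/setIidPr: (nbrs_sub K x) => ->; rewrite K3 Sx2.
have : c \in K :\: S x by rewrite Kc set11.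
rewrite in_setD => /andP[cS cK].
have ncx : adj c x = false by apply: contraNF cS => cx; rewrite inE cK.
have KE k : (k \in K) = [|| k == a, k == b | k == c].
  by rewrite -(setID K (S x)) Kc (setIidPr (nbrs_sub K x)) SE !inE -orbA.
have cKK : {in K &, forall k l, k != l -> adj k l} by case: maxK => /cliqueP.
have adj_ab : adj a b by apply: cKK.
have ac : a != c by apply: contraNneq cS => <-.
have bc : b != c by apply: contraNneq cS => <-.
have cx : c != x by apply: contraNneq xK => <-.
pose Q := [set a; b; x].
have Q3 : #|Q| = 3 by apply: card3.
have maxQ : max_clique Q.
  split; first exact: clique3.
  by move=> A cA; case: maxK => _ mK; rewrite Q3 -K3; apply: mK.
have sQ : stable (almost Q) by apply: (almost_stable maxQ w4); rewrite Q3.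
have sK : stable (almost K) by apply: (almost_stable maxK w4); rewrite K3.
pose T k := [set y in D | (S y == [set k]) && ~~ adj x y].
(* An edge in [T k] would form an induced [P3 u P2] with [c - l - x] *)
have sT k l : k \in K -> l \in K -> k != l -> k != c -> l != c -> adj l x -> stable (l |: T k).
  move=> kK lK kl kc lc lx.
  have Tl y m : y \in T k -> m \in K -> m != k -> adj m y = false.
    rewrite inE => /and3P[_ /eqP Sy _] mK mk; apply: contraNF mk => my.
    by have : m \in S y; [rewrite inE mK | rewrite Sy in_set1].
  move=> y z; rewrite !in_setU1 => /predU1P[->|yT] /predU1P[->|zT].
  - by rewrite adj_irrefl.
  - by rewrite (Tl z l) // eq_sym.
  - by rewrite adj_sym (Tl y l) // eq_sym.
  apply/negP=> yz; have cl : adj c l by apply: cKK; rewrite // eq_sym.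
  have := @p3p2 c l x y z cl lx cx; rewrite ncx => /(_ isT yz).
  have [xy xz] : ~~ adj x y /\ ~~ adj x z.
    by move: yT zT; rewrite !in_set => /and3P[_ _ ->] /and3P[_ _ ->].
  have ck : c != k by rewrite eq_sym.
  have lk : l != k by rewrite eq_sym.
  by rewrite (Tl y c) // (Tl z c) // (Tl y l) // (Tl z l) // (negPf xy) (negPf xz).
have ba : b != a by rewrite eq_sym.
have := col_union (col_union (col_stable sQ) (col_stable sK))
  (col_union (col_union (col_stable (sT a b aK bK ab ac bc bx))
                        (col_stable (sT b a bK aK ba bc ac ax))) (cB a c cK aK ac)).
apply: col_sub => //; apply/subsetP=> y _; have := in_setT y.
rewrite -(vertex_cover maxK) !in_setU !in_set1 KE.
have almostQ k l : k \in Q -> l \in Q -> k != l -> y \notin Q -> adj k y -> adj l y -> y \in almost Q.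
  move=> kQ lQ kl yQ ky ly; rewrite inE yQ Q3 /= eqn_leq.
  have := nbrs_proper maxQ yQ; rewrite Q3 ltnS => -> /=.
  apply: leq_trans (_ : #|[set k; l]| <= _); first by rewrite cards2 kl.
  by apply: subset_leq_card; apply/subsetP=> m; rewrite in_set2 in_nbrs => /orP[]/eqP->;
    rewrite ?kQ ?lQ.
case/orP=> [/orP[|->]|yD]; rewrite ?orbT //.
  case/or3P=> [->|->|/eqP yc]; rewrite ?orbT //.
  suff -> : y \in almost Q by [].
  apply: (almostQ a b); rewrite ?inE ?eqxx ?orbT //.
  - by rewrite yc !negb_or eq_sym ac eq_sym bc cx.
  - by apply: cKK; rewrite // ?yc.
  - by apply: cKK; rewrite // ?yc.
case: (types y yD) => [Sy|[k kK Sy]]; first by rewrite (inB y c) ?orbT // Sy sub0set.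
have yK := DK yD.
have yQ k' : k' \in K -> adj x y -> S y = [set k'] -> k' != c -> y \in almost Q.
  move=> k'K xy Sy' k'c; have k'y : adj k' y.
    by have : k' \in S y; [rewrite Sy' set11 | rewrite inE => /andP[]].
  have k'Q : k' \in Q.
    by move: k'K; rewrite KE (negPf k'c) orbF !inE => ->.
  apply: (almostQ k' x) => //; first by rewrite !inE eqxx orbT.
    by apply: contraNneq xK => <-.
  rewrite !inE !negb_or (eq_sym y x) (adj_neq xy) andbT.
  by rewrite !(contraNneq _ yK) // => ->.
move: kK; rewrite KE => /or3P[]/eqP kE; last by rewrite (inB y c) ?orbT // Sy kE.
- case xy: (adj x y); first by rewrite (yQ a) // -kE.
  by rewrite [y \in T a]inE yD Sy kE eqxx xy ?orbT.
- case xy: (adj x y); first by rewrite (yQ b) // -kE.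
  by rewrite [y \in T b]inE yD Sy kE eqxx xy ?orbT.
Qed.

Lemma col_3 : col [set: G] (2 * #|K|).
Proof.
rewrite K3; case: (boolP [exists i in K, [exists p in below i, [exists q in below i,
    [exists r in below i, [&& adj p q, adj p r & adj q r]]]]]).
  case/exists_inP=> i iK /exists_inP[p pB /exists_inP[q qB /exists_inP[r rB /and3P[pq pr qr]]]].
  exact: (col_triangle iK pB qB rB).
move=> none; apply: col_no_triangle => i p q r iK pB qB rB pq pr qr.
case/negP: none; apply/exists_inP; exists i => //; apply/exists_inP; exists p => //.
apply/exists_inP; exists q => //; apply/exists_inP; exists r => //; exact/and3P.
Qed.

End Three.

Lemma col_twice_max_clique : col [set: G] (2 * #|K|).
Proof.
have [K1|K1] := leqP #|K| 1; first exact: col_1.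
have [K2|K2] := eqVneq #|K| 2; first exact: col_2.
have [K3|K3] := eqVneq #|K| 3; first exact: col_3.
have [K4|K4] := eqVneq #|K| 4; first exact: col_4.
by apply: col_ge5; card_lia.
Qed.

End Cases.

Theorem theorem1p2 (G : sgraph) :
  free2 (disjoint_union (path_graph 3) (path_graph 2)) wheel4 G ->
  chi G <= 2 * omega G.
Proof.
case=> /free_p3p2 p3p2 /free_w4 w4.
have [K cK KE] : {K : {set G} | clique K & omega G = #|K|}.
  apply: eq_bigmax_cond; apply/card_gt0P; exists set0.
  by apply/cliqueP=> x y; rewrite inE.
have maxK : max_clique K.
  by split=> // A cA; rewrite -KE; apply: (leq_bigmax_cond (F := fun A : {set G} => #|A|)).
by apply: chi_col; rewrite KE; apply: col_twice_max_clique.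
Qed.
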